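(* Let $T>0$, $\nu>0$, and let $H$ be the Hamiltonian of the model described in the context. Assume that $h$ does not depend on $m$, i.e. $h[m](x)=u_T(x)$ with $u_T$ smooth on $\mathbb{T}^d$, that the initial probability density $m_0$ is a smooth positive function on $\mathbb{T}^d$, and that $(m,x,p)\mapsto H[m](x,p)$ is $C^2$ on $C(\mathbb{T}^d)\times\mathbb{T}^d\times\mathbb{R}^d$. For $m\in C(\mathbb{T}^d)$ and $p\in C(\mathbb{T}^d;\mathbb{R}^d)$ let $$\mathcal{H}[m,p]:=\int_{\mathbb{T}^d}m(x)\,H[m](x,p(x))\,dx,$$ and let $D^2_{m,m}\mathcal{H}[m,p]$ denote its second order Fréchet derivative with respect to $m$, a bilinear form on $C(\mathbb{T}^d)$. Suppose that 1. for all $m\in C(\mathbb{T}^d)\cap\mathbb{P}$ and all $p\in C(\mathbb{T}^d;\mathbb{R}^d)$, the quadratic form $\mu\mapsto D^2_{m,m}\mathcal{H}[m,p](\mu,\mu)$ is positive definite; 2. for all $m\in C(\mathbb{T}^d)\cap\mathbb{P}$ and $x\in\mathbb{T}^d$, the function $p\in\mathbb{R}^d\mapsto H[m](x,p)$ is strictly concave. Then there is at most one classical solution $(u,m)$ of the system $$\frac{\partial u}{\partial t}(t,x)+\nu\Delta u(t,x)+H[m(t,\cdot)](x,\nabla u(t,x))+\int_{\mathbb{T}^d}\frac{\partial H}{\partial m}[m(t,\cdot)](\xi,\nabla u(t,\xi))(x)\,m(t,\xi)\,d\xi=0,$$ $$\frac{\partial m}{\partial t}(t,x)-\nu\Delta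 m(t,x)+\mathrm{div}\Big(m(t,\cdot)\frac{\partial H}{\partial p}[m(t,\cdot)](\cdot,\nabla u(t,\cdot))\Big)(x)=0$$ in $(0,T)\times\mathbb{T}^d$, with $m(0,x)=m_0(x)$ and $u(T,x)=u_T(x)$ for $x\in\mathbb{T}^d$.
   Context: Notation: $\mathbb{T}^d=\mathbb{R}^d/\mathbb{Z}^d$ with distance $d(x,y)$. $\mathbb{P}$ is the set of probability measures on $\mathbb{T}^d$; absolutely continuous ones are identified with their densities, so $\mathbb{P}\cap L^1(\mathbb{T}^d)$ and $\mathbb{P}\cap C(\mathbb{T}^d)$ denote probability densities in $L^1$, resp. continuous ones. $d_2$ is the 2-Wasserstein distance on $\mathbb{P}$. Model. $g$ maps $\mathbb{P}$ into $C^1(\mathbb{T}^d\times\mathbb{R}^n;\mathbb{R}^d)$, $m\mapsto g[m]$, and there are constants $M,L$ such that for all $m,m'\in\mathbb{P}$, $x,y\in\mathbb{T}^d$, $a,b\in\mathbb{R}^n$: $|g[m](x,0)|\le M$, $|g[m](x,a)-g[m](y,a)|\le L\,d(x,y)$, $|g[m](x,a)-g[m](x,b)|\le L|a-b|$, $|g[m](x,a)-g[m'](x,a)|\le L\,d_2(m,m')$. $f$ maps $\mathbb{P}$ into $C^1(\mathbb{T}^d\times\mathbb{R}^n)$, with $\lim_{|a|\to\infty}\inf_{m\in\mathbb{P},x\in\mathbb{T}^d} f[m](x,a)/|a|=+\infty$. $h$ maps $\mathbb{P}$ into $C^1(\mathbb{T}^d)$. The restrictions of $g,f,h$ to $\mathbb{P}\cap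 L^1(\mathbb{T}^d)$ extend to maps on $L^1(\mathbb{T}^d)$ (denoted by the same letters) with values in the same spaces, Fréchet differentiable in $m\in L^1(\mathbb{T}^d)$ for fixed $(x,a)$ (resp. $x$), with $(x,a)\mapsto\frac{\partial g}{\partial m}[m](x,a)\in C^1(\mathbb{T}^d\times\mathbb{R}^n;L^\infty(\mathbb{T}^d;\mathbb{R}^d))$, $(x,a)\mapsto\frac{\partial f}{\partial m}[m](x,a)\in C^1(\mathbb{T}^d\times\mathbb{R}^n;L^\infty(\mathbb{T}^d))$, $x\mapsto\frac{\partial h}{\partial m}[m](x)\in C^1(\mathbb{T}^d;L^\infty(\mathbb{T}^d))$. The Hamiltonian is $H[m](x,p)=\min_{a\in\mathbb{R}^n}\big(f[m](x,a)+p\cdot g[m](x,a)\big)$ for $x\in\mathbb{T}^d$, $p\in\mathbb{R}^d$. It is assumed that the restriction of $H$ to $\mathbb{P}\cap L^1(\mathbb{T}^d)$ extends to a map (same letter) from $L^1(\mathbb{T}^d)$ to $C(\mathbb{T}^d\times\mathbb{R}^d)$ such that $m\mapsto H[m](x,p)$ is Fréchet differentiable in $L^1(\mathbb{T}^d)$ for every $(x,p)$, with $(x,p)\mapsto\frac{\partial H}{\partial m}[m](x,p)\in C^1(\mathbb{T}^d\times\mathbb{R}^d;L^\infty(\mathbb{T}^d))$; and that for $m\in\mathbb{P}\cap L^1(\mathbb{T}^d)$ and $a^*=\mathrm{argmin}_a\,(f[m](x,a)+p\cdot g[m](x,a))$ one has $\frac{\partial H}{\partial m}[m](x,p)=\frac{\partial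 f}{\partial m}[m](x,a^* )+p\cdot\frac{\partial g}{\partial m}[m](x,a^* )$. Here $\frac{\partial H}{\partial m}[m](\xi,p)(x)$ is the value at $x$ of the function in $L^\infty(\mathbb{T}^d)$ representing the Fréchet derivative of $m\mapsto H[m](\xi,p)$. A classical solution is a pair $(u,m)$ of functions on $[0,T]\times\mathbb{T}^d$, with $m(t,\cdot)$ a probability density for each $t$, possessing continuous derivatives of first order in $t$ and up to second order in $x$, for which the equations and the initial/terminal conditions hold pointwise. A quadratic form is positive definite if it is strictly positive at every nonzero vector. *)

(* Defs.v *)
From HB Require Import structures.
From mathcomp Require Import all_boot all_order all_algebra.
From mathcomp Require Import all_classical all_reals all_analysis.

Set Implicit Arguments.
Unset Strict Implicit.
Unset Printing Implicit Defensive.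

Import Order.TTheory GRing.Theory Num.Theory.
Import numFieldNormedType.Exports.

Local Open Scope classical_set_scope.
Local Open Scope ring_scope.

(* The torus T^d = R^d/Z^d is handled through R^d = 'rV[R]_d: functions on T^d
   are Z^d-periodic functions on R^d, and measures on T^d are measures on R^d
   carried by the fundamental domain [0,1)^d. *)

(* The Borel sigma-algebra of R^d, presented as the product sigma-algebra. *)
Section rV_measurable.
Context (R : realType) (d : nat).

Let coord : 'I_d -> 'rV[R]_d -> measurableTypeR R := fun i x => x ord0 i.

Let rV_measurable0 : g_sigma_preimage coord set0.
Proof. exact: sigma_algebra0. Qed.

Let rV_measurableC A :
  g_sigma_preimage coord A -> g_sigma_preimage coord (~` A).
Proof. exact: sigma_algebraC. Qed.

Let rV_measurable_bigcup (F : (set 'rV[R]_d)^nat) :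
  (forall i, g_sigma_preimage coord (F i)) ->
  g_sigma_preimage coord (\bigcup_i (F i)).
Proof. exact: sigma_algebra_bigcup. Qed.

HB.instance Definition _ := @isMeasurable.Build default_measure_display
  'rV[R]_d (g_sigma_preimage coord)
  rV_measurable0 rV_measurableC rV_measurable_bigcup.

End rV_measurable.

Section haar.
Context (R : realType).

Definition cons_rV (d : nat) (z : measurableTypeR R * 'rV[R]_d) : 'rV[R]_d.+1 :=
  \row_i oapp (z.2 ord0) z.1 (unlift ord0 i).

Lemma measurable_coord_rV (d : nat) (i : 'I_d) :
  measurable_fun setT (fun x : 'rV[R]_d => x ord0 i : measurableTypeR R).
Proof.
move=> _ Y mY; rewrite setTI; apply: sub_sigma_algebra => /=.
rewrite -bigcup_seq/=; exists i => /=; first by rewrite mem_index_enum.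
by exists Y => //; rewrite setTI.
Qed.

Lemma measurable_fun_rV d1 (T1 : measurableType d1) (d : nat)
    (f : T1 -> 'rV[R]_d) :
  (forall i, measurable_fun setT (fun x => f x ord0 i : measurableTypeR R)) ->
  measurable_fun setT f.
Proof.
move=> mf.
have : g_sigma_preimage
    (fun (i : 'I_d) x => f x ord0 i : measurableTypeR R) `<=` measurable.
  apply: smallest_sub; first exact: sigma_algebra_measurable.
  rewrite -bigcup_seq; apply: bigcup_sub => i _ A [B mB <-].
  exact: mf.
rewrite (_ : (fun (i : 'I_d) x => _) =
    fun i => (fun y : 'rV[R]_d => y ord0 i : measurableTypeR R) \o f) //.
rewrite g_sigma_preimage_comp => prefS _ A mA.
by apply: prefS; exists A.
Qed.

Lemma measurable_cons_rV (d : nat) : measurable_fun setT (@cons_rV d).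
Proof.
apply: measurable_fun_rV => i; rewrite /cons_rV.
case: (unliftP ord0 i) => [j ->|->].
  under eq_fun do rewrite mxE liftK /=.
  exact: (measurableT_comp (measurable_coord_rV j)).
under eq_fun do rewrite mxE unlift_none /=.
exact: measurable_fst.
Qed.

HB.instance Definition _ (d : nat) := @isMeasurableFun.Build _ _ _ _
  (@cons_rV d) (@measurable_cons_rV d).

Section uniform_cons.
Context (d : nat) (P : probability 'rV[R]_d R).

Definition uniform_cons_prod := (uniform_prob (@ltr01 R) \x P)%E.

HB.instance Definition _ := Measure.on uniform_cons_prod.

Let uniform_cons_prodT : uniform_cons_prod setT = 1%E.
Proof.
rewrite /uniform_cons_prod -setXTT product_measure1E//.
rewrite -[RHS]mule1; congr (_ * _)%E; exact: probability_setT.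
Qed.

HB.instance Definition _ := Measure_isProbability.Build _ _ _
  uniform_cons_prod uniform_cons_prodT.

Definition uniform_cons : probability 'rV[R]_d.+1 R :=
  distribution uniform_cons_prod (@cons_rV d).

End uniform_cons.

(* Lebesgue measure on the unit cube, i.e. the measure dx of T^d. It is a
   measure on R^d carried by the cube, so that an integral over T^d is an
   integral over the whole space against [haar]. *)
Fixpoint haar (d : nat) : probability 'rV[R]_d R :=
  if d is d'.+1 then uniform_cons (haar d') else \d_(0 : 'rV[R]_0).

End haar.
Arguments haar {R d}.

Section torus.
Context (R : realType) (d : nat).
Implicit Types (x y : 'rV[R]_d).

Definition dot x y : R := \sum_i x ord0 i * y ord0 i.

(* The library norm on row vectors is the sup norm. *)
Definition enorm (k : nat) (a : 'rV[R]_k) : R :=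
  Num.sqrt (\sum_i a ord0 i ^+ 2).

Definition lattice (k : 'rV[int]_d) : 'rV[R]_d := map_mx intr k.

Definition Zperiodic (S : Type) (f : 'rV[R]_d -> S) : Prop :=
  forall x k, f (x + lattice k) = f x.

Definition torus_dist x y : R :=
  inf [set enorm (x - y + lattice k) | k in [set: 'rV[int]_d]].

Definition on_torus (mu : probability 'rV[R]_d R) : Prop :=
  mu [set x | forall i, 0 <= x ord0 i < 1] = 1%E.

Definition coupling (mu nu : probability 'rV[R]_d R) :
    set (probability ('rV[R]_d * 'rV[R]_d)%type R) :=
  [set pi : probability ('rV[R]_d * 'rV[R]_d)%type R |
    forall A, measurable A ->
      pi (A `*` setT) = mu A /\ pi (setT `*` A) = nu A].

Definition wasserstein2 (mu nu : probability 'rV[R]_d R) : R :=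
  Num.sqrt (inf [set \int[pi]_z (torus_dist z.1 z.2 ^+ 2)
                | pi in coupling mu nu]).

Definition prob_density (m : 'rV[R]_d -> R) : Prop :=
  [/\ m \in Lfun (@haar R d) 1,
      {ae @haar R d, forall x, 0 <= m x} &
      \int[@haar R d]_x m x = 1].

Definition has_density (mu : probability 'rV[R]_d R) (m : 'rV[R]_d -> R) : Prop :=
  forall A, measurable A -> mu A = (\int[@haar R d]_(x in A) (m x)%:E)%E.

End torus.

Section continuous_functions_on_the_torus.
Context (R : realType) (d : nat).

Definition torus_continuous : {pred 'rV[R]_d -> R} :=
  mem [set f : 'rV[R]_d -> R | continuous f /\ Zperiodic f].

(* The Banach space C(T^d), with the sup norm. *)
Record ctorus := CTorus {
  ctorus_fun :> 'rV[R]_d -> R;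
  _ : ctorus_fun \in torus_continuous }.

HB.instance Definition _ := [isSub for ctorus_fun].
HB.instance Definition _ := [Choice of ctorus by <:].

Lemma torus_continuous_submod_closed : submod_closed torus_continuous.
Proof.
split.
  by rewrite inE; split=> // x; exact: cst_continuous.
move=> a f g; rewrite !inE => -[cf pf] [cg pg]; split=> [x|x k].
  by apply: continuousD; [apply: continuousZr|]; [exact: cf|exact: cg].
by rewrite -[LHS]/(a *: f (x + lattice R k) + g (x + lattice R k)) pf pg.
Qed.

HB.instance Definition _ := GRing.isSubmodClosed.Build _ _ torus_continuous
  torus_continuous_submod_closed.
HB.instance Definition _ := [SubChoice_isSubLmodule of ctorus by <:].

Lemma ctorus_continuous (f : ctorus) : continuous f.
Proof. by have := valP f; rewrite inE => -[]. Qed.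

Lemma ctorus_periodic (f : ctorus) : Zperiodic f.
Proof. by have := valP f; rewrite inE => -[]. Qed.

Lemma ctorusD (f g : ctorus) x : (f + g) x = f x + g x.
Proof. by []. Qed.

Lemma ctorusZ (a : R) (f : ctorus) x : (a *: f) x = a * f x.
Proof. by []. Qed.

Lemma periodic_cube (f : 'rV[R]_d -> R) (x : 'rV[R]_d) : Zperiodic f ->
  exists2 y : 'rV[R]_d, (forall i, `[0, 1]%classic (y ord0 i)) & f y = f x.
Proof.
move=> pf; exists (x + lattice R (\row_i - Num.floor (x ord0 i))) => [i|].
  have /andP[xl] := floor_itv (x ord0 i); rewrite rmorphD/= => /ltW xu.
  by rewrite /= !mxE in_itv/= rmorphN/= subr_ge0 xl lerBlDl.
exact: pf.
Qed.

Lemma ctorus_bounded (f : ctorus) : has_ubound [set `|f x| | x in setT].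
Proof.
have /compact_bounded[M [_ Mf]] : compact [set f x | x in
    [set v : 'rV[R]_d | forall i, `[0, 1]%classic (v ord0 i)]].
  apply: continuous_compact.
    by apply: continuous_subspaceT; exact: ctorus_continuous.
  by apply: (@rV_compact R d (fun=> `[0, 1]%classic)) => i; exact: segment_compact.
exists (M + 1) => _ [x _ <-].
have [y y01 <-] := periodic_cube x (@ctorus_periodic f).
by apply: Mf; [rewrite ltrDl|exists y].
Qed.

Definition ctorus_norm (f : ctorus) : R := sup [set `|f x| | x in setT].

Let nonempty_range (f : ctorus) : [set `|f x| | x in setT] !=set0.
Proof. by exists `|f 0|, 0. Qed.

Lemma ctorus_norm_ub (f : ctorus) x : `|f x| <= ctorus_norm f.
Proof. by apply: ub_le_sup; [exact: ctorus_bounded|exists x]. Qed.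

Lemma ctorus_normD (f g : ctorus) :
  ctorus_norm (f + g) <= ctorus_norm f + ctorus_norm g.
Proof.
apply: ge_sup => // _ [x _ <-]; rewrite ctorusD.
by rewrite (le_trans (ler_normD _ _))// lerD// ctorus_norm_ub.
Qed.

Let ctorus_normZ_le (a : R) (f : ctorus) :
  ctorus_norm (a *: f) <= `|a| * ctorus_norm f.
Proof.
apply: ge_sup => // _ [x _ <-]; rewrite ctorusZ normrM.
by rewrite ler_wpM2l// ctorus_norm_ub.
Qed.

Lemma ctorus_normZ (a : R) (f : ctorus) :
  ctorus_norm (a *: f) = `|a| * ctorus_norm f.
Proof.
have [->|a0] := eqVneq a 0.
  rewrite normr0 mul0r scale0r /ctorus_norm.
  rewrite (_ : [set _ | _ in _] = [set 0]) ?sup1//.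
  by apply/seteqP; split=> [_ [x _ <-]|_ ->] /=; [|exists 0 => //];
    rewrite normr0.
apply/eqP; rewrite eq_le ctorus_normZ_le/=.
rewrite -ler_pdivlMl ?normr_gt0// -normfV.
by rewrite -[leLHS]/(ctorus_norm f) -{1}(scalerK a0 f).
Qed.

Lemma ctorus_norm0_eq0 (f : ctorus) : ctorus_norm f = 0 -> f = 0.
Proof.
move=> f0; apply/val_inj/funext => x.
by apply/eqP; rewrite -normr_le0 -f0; exact: ctorus_norm_ub.
Qed.

HB.instance Definition _ := Lmodule_isNormed.Build R ctorus
  ctorus_normD ctorus_normZ ctorus_norm0_eq0.

End continuous_functions_on_the_torus.
Arguments lattice {R d}.

Section frechet_regularity.
Context (R : realType).

Definition C1 (V W : normedModType R) (F : V -> W) : Prop :=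
  (forall v, differentiable F v) /\
  (forall v (e : R), 0 < e ->
    \forall w \near v, forall h, `|'d F w h - 'd F v h| <= e * `|h|).

(* second order differential of F at v, as a bilinear form *)
Definition D2 (V : normedModType R) (F : V -> R) (v h k : V) : R :=
  'd (fun w => 'd F w k : R) v h.

(* [D2 F v] is a bounded bilinear form, it is the derivative at v of ['d F] for
   the operator norm, and it depends continuously on v for the norm of bilinear
   forms. *)
Definition C2 (V : normedModType R) (F : V -> R) : Prop :=
  [/\ forall v, differentiable F v,
      forall v, exists C : R, forall h k, `|D2 F v h k| <= C * `|h| * `|k|,
      forall v (e : R), 0 < e -> \forall h \near (0 : V), forall k,
        `|'d F (v + h) k - 'd F v k - D2 F v h k| <= e * `|h| * `|k| &
      forall v (e : R), 0 < e -> \forall w \near v, forall h k,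
        `|D2 F w h k - D2 F v h k| <= e * `|h| * `|k|].

End frechet_regularity.

Section calculus.
Context (R : realType) (d : nat).
Implicit Types (f : 'rV[R]_d -> R) (x : 'rV[R]_d) (i j : 'I_d).

Definition basis i : 'rV[R]_d := delta_mx ord0 i.

Definition partial i f x : R := 'D_(basis i) f x.

Definition grad f x : 'rV[R]_d := \row_i partial i f x.

Definition laplacian f x : R := \sum_i partial i (partial i f) x.

Definition divergence (v : 'rV[R]_d -> 'rV[R]_d) x : R :=
  \sum_i partial i (fun y => v y ord0 i) x.

Fixpoint iter_partial (s : seq 'I_d) f : 'rV[R]_d -> R :=
  if s is i :: s' then iter_partial s' (partial i f) else f.

Definition smooth f : Prop := forall s,
  continuous (iter_partial s f) /\
  forall i x, derivable (iter_partial s f) x (basis i).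

(* Functions on [0,T] x T^d with continuous derivatives up to the boundary, of
   first order in t (one-sided at t = 0 and t = T) and up to second order in
   x. *)
Definition C12 (T : R) (u : R -> 'rV[R]_d -> R) : Prop :=
  let I := `[0, T]%classic : set R in
  let D := I `*` [set: 'rV[R]_d] in
  [/\ {within D, continuous (fun z => u z.1 z.2)},
      exists2 ut : R -> 'rV[R]_d -> R,
        {within D, continuous (fun z => ut z.1 z.2)} &
        forall t x, I t ->
          ((s - t)^-1 * (u s x - u t x)) @[s --> within I (dnbhs t)] --> ut t x,
      forall i, {within D, continuous (fun z => partial i (u z.1) z.2)} /\
        forall t x, I t -> derivable (u t) x (basis i) &
      forall i j,
        {within D, continuous (fun z => partial j (partial i (u z.1)) z.2)} /\
        forall t x, I t -> derivable (partial i (u t)) x (basis j)].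

Definition normL1 (f : 'rV[R]_d -> R) : \bar R := 'N[@haar R d]_1[EFin \o f]%E.

Definition normLinf (f : 'rV[R]_d -> R) : \bar R :=
  'N[@haar R d]_+oo[EFin \o f]%E.

(* F is Frechet differentiable at m in L^1(T^d), and its derivative, an element
   of the dual of L^1(T^d), is represented by k in L^oo(T^d). Taking mu = 0 a.e.
   shows that such an F does not distinguish between a.e. equal functions. *)
Definition frechet_L1 (F : ('rV[R]_d -> R) -> R) (m k : 'rV[R]_d -> R) : Prop :=
  k \in Lfun (@haar R d) +oo /\
  forall e : R, 0 < e -> exists2 delta : R, 0 < delta &
    forall mu : 'rV[R]_d -> R, mu \in Lfun (@haar R d) 1 ->
      (normL1 mu < delta%:E)%E ->
      ((`|F (m \+ mu) - F m - \int[@haar R d]_y (k y * mu y)|)%:E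
        <= e%:E * normL1 mu)%E.

(* v |-> K v is a C^1 map from V to L^oo(T^d), with differential DK. It is only
   used for finite dimensional V, where the linear maps DK v are bounded. *)
Definition C1_Linf (V : normedModType R) (K : V -> 'rV[R]_d -> R) : Prop :=
  (forall v, K v \in Lfun (@haar R d) +oo) /\
  exists DK : V -> V -> 'rV[R]_d -> R,
    [/\ forall v h, DK v h \in Lfun (@haar R d) +oo,
        forall v (a : R) h h' y, DK v (a *: h + h') y = a * DK v h y + DK v h' y,
        forall v (e : R), 0 < e -> \forall h \near (0 : V),
          (normLinf (fun y => K (v + h) y - K v y - DK v h y)%R
            <= (e * `|h|)%:E)%E &
        forall v (e : R), 0 < e -> \forall w \near v, forall h,
          (normLinf (fun y => DK w h y - DK v h y)%R <= (e * `|h|)%:E)%E].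

Definition strictly_concave (F : 'rV[R]_d -> R) : Prop :=
  forall p q (t : R), p != q -> 0 < t < 1 ->
    t * F p + (1 - t) * F q < F (t *: p + (1 - t) *: q).

End calculus.

Section model.
Context (R : realType) (d n : nat).

(* [gP], [fP], [hP] are the maps on probability measures; [gL], [fL], [hL], [HL]
   are the extensions to L^1(T^d) of their (and of the Hamiltonian's)
   restrictions to probability densities; [dg], [df], [dh], [dH] are the
   representatives of the Frechet derivatives of these extensions: [dH m xi p x]
   is the value at x of the derivative at m of m |-> HL m xi p. *)
Record mfc_data := MfcData {
  gP : probability 'rV[R]_d R -> 'rV[R]_d -> 'rV[R]_n -> 'rV[R]_d;
  gL : ('rV[R]_d -> R) -> 'rV[R]_d -> 'rV[R]_n -> 'rV[R]_d;
  dg : ('rV[R]_d -> R) -> 'rV[R]_d -> 'rV[R]_n -> 'rV[R]_d -> 'rV[R]_d;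
  fP : probability 'rV[R]_d R -> 'rV[R]_d -> 'rV[R]_n -> R;
  fL : ('rV[R]_d -> R) -> 'rV[R]_d -> 'rV[R]_n -> R;
  df : ('rV[R]_d -> R) -> 'rV[R]_d -> 'rV[R]_n -> 'rV[R]_d -> R;
  hP : probability 'rV[R]_d R -> 'rV[R]_d -> R;
  hL : ('rV[R]_d -> R) -> 'rV[R]_d -> R;
  dh : ('rV[R]_d -> R) -> 'rV[R]_d -> 'rV[R]_d -> R;
  HL : ('rV[R]_d -> R) -> 'rV[R]_d -> 'rV[R]_d -> R;
  dH : ('rV[R]_d -> R) -> 'rV[R]_d -> 'rV[R]_d -> 'rV[R]_d -> R }.

Variable D : mfc_data.

Local Notation L1 := (Lfun (@haar R d) 1).

(* The derivative of gL takes its values in L^oo(T^d; R^d) and is handled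
   coordinatewise. *)
Definition g_assumptions : Prop :=
  [/\ forall mu, on_torus mu ->
        (forall a, Zperiodic (fun x => gP D mu x a)) /\
        C1 (fun z : 'rV[R]_d * 'rV[R]_n => gP D mu z.1 z.2),
      exists M L : R, forall mu mu' x y a b, on_torus mu -> on_torus mu' ->
        [/\ enorm (gP D mu x 0) <= M,
            enorm (gP D mu x a - gP D mu y a) <= L * torus_dist x y,
            enorm (gP D mu x a - gP D mu x b) <= L * enorm (a - b) &
            enorm (gP D mu x a - gP D mu' x a) <= L * wasserstein2 mu mu'],
      forall mu m, on_torus mu -> m \in L1 -> has_density mu m ->
        gL D m = gP D mu,
      forall m, m \in L1 ->
        (forall a, Zperiodic (fun x => gL D m x a)) /\
        C1 (fun z : 'rV[R]_d * 'rV[R]_n => gL D m z.1 z.2) &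
      forall m, m \in L1 -> forall i,
        (forall x a, frechet_L1 (fun m' => gL D m' x a ord0 i) m
                       (fun y => dg D m x a y ord0 i)) /\
        C1_Linf (fun (z : 'rV[R]_d * 'rV[R]_n) y => dg D m z.1 z.2 y ord0 i)].

Definition f_assumptions : Prop :=
  [/\ forall mu, on_torus mu ->
        (forall a, Zperiodic (fun x => fP D mu x a)) /\
        C1 (fun z : 'rV[R]_d * 'rV[R]_n => fP D mu z.1 z.2),
      forall A : R, exists r : R, forall a, r < enorm a ->
        forall mu x, on_torus mu -> A <= fP D mu x a / enorm a,
      forall mu m, on_torus mu -> m \in L1 -> has_density mu m ->
        fL D m = fP D mu,
      forall m, m \in L1 ->
        (forall a, Zperiodic (fun x => fL D m x a)) /\
        C1 (fun z : 'rV[R]_d * 'rV[R]_n => fL D m z.1 z.2) &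
      forall m, m \in L1 ->
        (forall x a, frechet_L1 (fun m' => fL D m' x a) m (df D m x a)) /\
        C1_Linf (fun z : 'rV[R]_d * 'rV[R]_n => df D m z.1 z.2)].

Definition h_assumptions : Prop :=
  [/\ forall mu, on_torus mu -> Zperiodic (hP D mu) /\ C1 (hP D mu),
      forall mu m, on_torus mu -> m \in L1 -> has_density mu m ->
        hL D m = hP D mu,
      forall m, m \in L1 -> Zperiodic (hL D m) /\ C1 (hL D m) &
      forall m, m \in L1 ->
        (forall x, frechet_L1 (fun m' => hL D m' x) m (dh D m x)) /\
        C1_Linf (dh D m)].

Definition is_min (E : set R) (v : R) : Prop := E v /\ lbound E v.

(* The last two clauses on dH select its representatives: a continuous map from
   (xi, p) to L^oo(T^d) always has a representative which is periodic and
   jointly measurable in (xi, p, x), as is needed for its integral in xi to make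
   sense as a function of x. *)
Definition H_assumptions : Prop :=
  [/\ forall mu m, on_torus mu -> m \in L1 -> has_density mu m -> forall x p,
        is_min (range (fun a => fP D mu x a + dot p (gP D mu x a))) (HL D m x p),
      forall m, m \in L1 ->
        (forall p, Zperiodic (fun x => HL D m x p)) /\
        continuous (fun z : 'rV[R]_d * 'rV[R]_d => HL D m z.1 z.2),
      forall m, m \in L1 ->
        [/\ forall x p, frechet_L1 (fun m' => HL D m' x p) m (dH D m x p),
            C1_Linf (fun z : 'rV[R]_d * 'rV[R]_d => dH D m z.1 z.2),
            (forall p y, Zperiodic (fun x => dH D m x p y)) /\
            (forall x p, Zperiodic (dH D m x p)) &
            measurable_fun setT
              (fun z : 'rV[R]_d * 'rV[R]_d * 'rV[R]_d =>
                dH D m z.1.1 z.1.2 z.2)] &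
      forall m, prob_density m -> forall x p astar,
        (forall a, fL D m x astar + dot p (gL D m x astar)
                   <= fL D m x a + dot p (gL D m x a)) ->
        {ae @haar R d, forall y,
          dH D m x p y = df D m x astar y + dot p (dg D m x astar y)}].

Definition mfc_assumptions : Prop :=
  [/\ g_assumptions, f_assumptions, h_assumptions & H_assumptions].

Definition calH (p : 'rV[R]_d -> 'rV[R]_d) (m : ctorus R d) : R :=
  \int[@haar R d]_x (m x * HL D m x (p x)).

Definition dHdp (m : 'rV[R]_d -> R) (x p : 'rV[R]_d) : 'rV[R]_d :=
  grad (HL D m x) p.

Record classical_solution (T nu : R) (uT m0 : 'rV[R]_d -> R)
    (u m : R -> 'rV[R]_d -> R) : Prop := ClassicalSolution {
  sol_periodic : forall t, 0 <= t <= T -> Zperiodic (u t) /\ Zperiodic (m t);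
  sol_C12 : C12 T u /\ C12 T m;
  sol_density : forall t, 0 <= t <= T -> prob_density (m t);
  sol_HJB : forall t x, 0 < t < T ->
    derive1 (u ^~ x) t + nu * laplacian (u t) x + HL D (m t) x (grad (u t) x)
    + \int[@haar R d]_xi (dH D (m t) xi (grad (u t) xi) x * m t xi) = 0;
  sol_FP : forall t x, 0 < t < T ->
    derive1 (m ^~ x) t - nu * laplacian (m t) x
    + divergence (fun y => m t y *: dHdp (m t) y (grad (u t) y)) x = 0;
  sol_initial : forall x, m 0 x = m0 x;
  sol_terminal : forall x, u T x = uT x }.

End model.

(* Main.v *)
Require Import Defs.
From HB Require Import structures.
From mathcomp Require Import all_boot all_order all_algebra.
From mathcomp Require Import all_classical all_reals all_analysis.
From mathcomp Require Import measurable_realfun ess_sup_inf ring lra.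

Set Implicit Arguments.
Unset Strict Implicit.
Unset Printing Implicit Defensive.

Import Order.TTheory GRing.Theory Num.Theory.
Import numFieldNormedType.Exports.

Local Open Scope classical_set_scope.
Local Open Scope ring_scope.

(** Uniqueness is proved by duality, in the manner of Lasry and Lions.  Let
    (u1, m1) and (u2, m2) be two solutions, w = u1 - u2, mu = m1 - m2 and
    p_i = grad u_i.  The two equations and integrations by parts on the torus
    show that the pairing Phi t = int w(t) mu(t) has the derivative

      E = int (p1 - p2) . (m1 D_pH[m1](., p1) - m2 D_pH[m2](., p2))
          - (D_m calH[m1, p1] - D_m calH[m2, p2]) mu

    at every time of (0, T) ([energy_identity], [duality_derivative]): the
    Laplacians cancel, and the local and nonlocal terms of the equation for u_i
    add up to the density of the differential of calH in m.  Now add four tangent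
    inequalities: calH[., p1] at m1, calH[., p2] at m2, both convex, and
    H[m1](x, .) at p1, H[m2](x, .) at p2, both concave.  All the values of calH
    cancel and E <= 0 remains.  Moreover E = 0 only if all four are equalities,
    which forces m1 = m2 and, by strict concavity, p1 = p2 at almost every point
    where m1 does not vanish ([energy_le0]).  Phi is therefore nonincreasing; it
    vanishes at t = 0, where the densities agree, and at t = T, where u1 and u2
    agree, so E = 0 at all times of (0, T) ([densities_agree]).

    It remains to compare u1 and u2.  The nonlocal term weights the momentum at
    xi by m(xi), and p1 = p2 almost everywhere m is nonzero; so the nonlocal terms
    of both equations coincide, and
      w_t + nu Lap w + H[m](x, p1) - H[m](x, p2) = 0,   w(T) = 0.
    At a critical point of w the Hamiltonians cancel, hence the parabolic maximum
    principle applies and gives w <= 0 ([parabolic_maximum], [values_le]); by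
    symmetry w = 0.

    Two links with the abstract hypotheses need care.  First, the differential of
    H in m as a function on C(T^d) must be identified with the L^oo density of its
    Frechet derivative on L^1(T^d), and then integrated over the torus by Fubini
    ([HL_diff_density], [nonlocal_pairing]); the integrability is a compactness
    argument ([C1_Linf_cube]).  Second, the convexity hypothesis speaks of the
    second differential of calH.  One proves that calH is Frechet differentiable
    ([averaged_differentiable]); the differentiability of its differential along a
    segment then comes for free, since the differential of a function is zero
    where it does not exist, whereas here it is positive
    ([diff_neq0_differentiable], [D2_gt0_convex]). *)

(** * Continuous functions and the Haar measure of the torus *)

Section continuous_haar.
Context {R : realType}.

Lemma cvg_rV (T : Type) (F : set_system T) (FF : Filter F) d
    (f : T -> 'rV[R]_d) (l : 'rV[R]_d) :
  (forall i, f x ord0 i @[x --> F] --> l ord0 i) -> f @ F --> l.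
Proof.
move=> fl; apply/cvg_ballP => e e0.
have : \forall x \near F, forall i, ball (l ord0 i) e (f x ord0 i).
  by apply: filter_forall => i; move/cvg_ballP : (fl i); exact.
by apply: filterS => x xl; split=> // i j; rewrite ord1.
Qed.

Lemma continuous_rV (S : topologicalType) d (f : S -> 'rV[R]_d) :
  (forall i, continuous (fun s => f s ord0 i)) -> continuous f.
Proof. by move=> cf s; apply: cvg_rV => i; exact: cf. Qed.

(** The sigma-algebra is the product one, so an open set has to be a countable
    union of measurable boxes: those with rational centre and radius that it
    contains. *)
Lemma open_measurable_rV d (U : set 'rV[R]_d) : open U -> measurable U.
Proof.
move=> oU.
pose box (q : 'rV[rat]_d * rat) : set 'rV[R]_d :=
  [set x | forall i, `|x ord0 i - ratr (q.1 ord0 i)| < ratr q.2].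
pose F q := if `[< box q `<=` U >] then box q else set0.
have mbox q : measurable (box q).
  rewrite (_ : box q = \bigcap_(i in [set: 'I_d]) ((fun x : 'rV[R]_d => x ord0 i) @^-1`
      `]ratr (q.1 ord0 i) - ratr q.2, ratr (q.1 ord0 i) + ratr q.2[%classic)).
    apply: fin_bigcap_measurable => [|i _]; first exact: finite_finset.
    by rewrite -[X in measurable X]setTI; apply: measurable_coord_rV.
  by apply/seteqP; split => x /= xq i *; have := xq i; rewrite /= in_itv/= ltr_distl;
    apply.
have -> : U = \bigcup_q F q.
  apply/seteqP; split => [x Ux|x [q _]]; last first.
    by rewrite /F; case: asboolP => // qU /qU.
  have : nbhs x U by apply: open_nbhs_nbhs.
  move=> /nbhs_ballP[e /= e0 eU].
  have [r /[!in_itv]/= /andP[r0 re]] := rat_in_itvoo (divr_gt0 e0 (ltr0n _ 2)).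
  have qx i : exists q, `|x ord0 i - ratr q| < ratr r.
    have [|q /[!in_itv]/= xq] := @rat_in_itvoo R (x ord0 i - ratr r) (x ord0 i + ratr r).
      by rewrite ltrD2l gt0_cp.
    by exists q; rewrite distrC ltr_distl.
  pose q : 'rV[rat]_d := \row_i sval (cid (qx i)).
  have qE i : `|x ord0 i - ratr (q ord0 i)| < ratr r.
    by rewrite mxE; case: cid.
  exists (q, r) => //; rewrite /F asboolT// => y yq; apply: eU.
  split => // i j; rewrite ord1 /ball/=.
  have -> : x ord0 j - y ord0 j = (x ord0 j - ratr (q ord0 j)) - (y ord0 j - ratr (q ord0 j)).
    by rewrite opprB addrA subrK.
  rewrite (le_lt_trans (ler_normB _ _))// (splitr e) ltrD//.
    by rewrite (lt_trans (qE j)).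
  by rewrite (lt_trans (yq j)).
apply: countable_bigcupT_measurable => [|q]; first exact: countableP.
by rewrite /F; case: asboolP.
Qed.

Lemma continuous_measurable_rV d (f : 'rV[R]_d -> R) :
  continuous f -> measurable_fun setT f.
Proof.
move=> /continuousP cf; apply: (measurability _ (RGenOpens.measurableE R)).
move=> _ [_ [a [b ->] <-]]; rewrite setTI; apply: open_measurable_rV.
exact/cf/interval_open.
Qed.

(** The closed unit cube: compact, of full Haar measure, and meeting every
    Z^d-orbit; it stands for the torus in all compactness arguments. *)
Definition cube d : set 'rV[R]_d := [set x | forall i, `[0, 1]%classic (x ord0 i)].

Lemma compact_cube d : compact (@cube d).
Proof.
by apply: (@rV_compact R d (fun=> `[0, 1]%classic)) => i; exact: segment_compact.
Qed.

Lemma measurable_cube d : measurable (@cube d).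
Proof.
rewrite (_ : @cube d = \bigcap_(i in [set: 'I_d]) ((fun x : 'rV[R]_d => x ord0 i) @^-1`
    `[0, 1]%classic)).
  apply: fin_bigcap_measurable => [|i _]; first exact: finite_finset.
  by rewrite -[X in measurable X]setTI; apply: measurable_coord_rV.
by apply/seteqP; split => x /= xq i *; exact: xq.
Qed.

Lemma cons_rV0 d z (y : 'rV[R]_d) : cons_rV (z, y) ord0 ord0 = z.
Proof. by rewrite mxE unlift_none. Qed.

Lemma cons_rVS d z (y : 'rV[R]_d) i :
  cons_rV (z, y) ord0 (lift ord0 i) = y ord0 i.
Proof. by rewrite mxE liftK. Qed.

Lemma haar_cube d : haar (~` @cube d) = 0%E.
Proof.
elim: d => [|d IH].
  rewrite /= diracE memNset// => /(_ _); apply; by case.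
have mC : measurable (~` @cube d) by apply: measurableC; exact: measurable_cube.
have h1 : haar (@cube d) = 1%E.
  have := @probability_setC _ _ _ (@haar R d) _ mC.
  by rewrite setCK IH sube0.
have -> : (@haar R d.+1) (~` @cube d.+1) =
   uniform_cons_prod (@haar R d) (cons_rV (d:=d) @^-1` (~` @cube d.+1)) by [].
have -> : cons_rV (d:=d) @^-1` (~` @cube d.+1) =
    ~` ((`[0, 1]%classic : set (measurableTypeR R)) `*` @cube d).
  rewrite preimage_setC; congr (~` _); apply/seteqP; split => -[z y] /=.
    move=> h; split; first by have := h ord0; rewrite cons_rV0.
    by move=> i; have := h (lift ord0 i); rewrite cons_rVS.
  move=> [hz hy] i; case: (unliftP ord0 i) => [j ->|->].
    by rewrite cons_rVS; exact: hy.
  by rewrite cons_rV0.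
rewrite probability_setC; last first.
  by apply: measurableX => //; exact: measurable_cube.
transitivity (1 - 1 : \bar R)%E; last by rewrite subee.
congr (_ - _)%E.
have mI : measurable (`[0%R, 1%R]%classic : set (measurableTypeR R)) by [].
transitivity ((uniform_prob (@ltr01 R) \x @haar R d)%E
  ((`[0%R, 1%R]%classic : set (measurableTypeR R)) `*` @cube d)); first by [].
rewrite product_measure1E//; last exact: measurable_cube.
rewrite -[RHS]mule1; congr (_ * _)%E; last exact: h1.
exact: integral_uniform_pdf1.
Qed.

Lemma continuous_bounded_cube d (f : 'rV[R]_d -> R) : continuous f ->
  exists2 M : R, 0 <= M & forall x, cube x -> `|f x| <= M.
Proof.
move=> cf.
have /compact_bounded[M [_ Mf]] : compact (f @` @cube d).
  by apply: continuous_compact; [exact: continuous_subspaceT|exact: compact_cube].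
exists (Num.max M 0 + 1); first by rewrite addr_ge0// le_max lexx orbT.
move=> x Kx; apply: Mf; last by exists x.
by rewrite (@le_lt_trans _ _ (Num.max M 0))// ?ltrDl// le_max lexx.
Qed.

Lemma bounded_cube_integrable d (f : 'rV[R]_d -> R) (M : R) :
  measurable_fun setT f -> (forall x, cube x -> `|f x| <= M) ->
  (@haar R d).-integrable setT (EFin \o f).
Proof.
move=> mf fM; have mC := @measurable_cube d.
apply/(@negligible_integrable _ _ _ _ _ (~` @cube d)) => //.
- exact: measurableC.
- exact/measurable_EFinP.
- exact: haar_cube.
rewrite setTD setCK; apply: measurable_bounded_integrable => //.
- by rewrite -ge0_fin_numE// fin_num_measure.
- exact: measurable_funTS.
- exists M; split; first exact: num_real.
  by move=> x Mx y Ky /=; rewrite (le_trans (fM _ Ky))// ltW.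
Qed.

Lemma continuous_haar_integrable d (f : 'rV[R]_d -> R) : continuous f ->
  (@haar R d).-integrable setT (EFin \o f).
Proof.
move=> cf; have [M _ fM] := continuous_bounded_cube cf.
by apply: (@bounded_cube_integrable _ _ M) => //; exact: continuous_measurable_rV.
Qed.

End continuous_haar.
Arguments cube {R d}.

(** * Partial derivatives have zero mean *)

Section haar_recursion.
Context {R : realType}.

(** Transfers the integral against the uniform law, in which the Haar measure is
    expressed, to the Lebesgue integral on [0, 1], to which the fundamental
    theorem of calculus applies. *)
Lemma integral_uniform01 (g : R -> R) : continuous g ->
  (\int[uniform_prob (@ltr01 R)]_z (g z)%:E =
   \int[lebesgue_measure]_(z in `[0%R, 1%R]) (g z)%:E)%E.
Proof.
move=> cg.
have mg : measurable_fun [set: measurableTypeR R] (EFin \o g).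
  by apply/measurable_EFinP; exact: continuous_measurable_fun.
rewrite integralE [RHS]integralE !integral_uniform//;
  try exact: measurable_funepos; try exact: measurable_funeneg.
by rewrite subr0 invr1 !mul1e.
Qed.

Lemma cons_rV_basis0 d h z (y : 'rV[R]_d) :
  h *: Defs.basis R ord0 + cons_rV (z, y) = cons_rV (h + z, y).
Proof.
apply/rowP => i; rewrite /Defs.basis !mxE eqxx /=.
by case: (unliftP ord0 i) => [j ->|->]; rewrite ?liftK ?unlift_none /= ?eqxx /=
  ?mulr1 ?mulr0 ?add0r// eq_sym (negbTE (neq_lift _ _)) mulr0 add0r.
Qed.

Lemma cons_rV_basisS d h z (y : 'rV[R]_d) i :
  h *: Defs.basis R (lift ord0 i) + cons_rV (z, y) = cons_rV (z, h *: Defs.basis R i + y).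
Proof.
apply/rowP => j; rewrite /Defs.basis !mxE eqxx /=.
case: (unliftP ord0 j) => [k ->|->]; rewrite ?liftK ?unlift_none /= ?mxE ?eqxx/=.
  by rewrite (inj_eq lift_inj).
by rewrite mulr0 add0r.
Qed.

Lemma continuous_cons_rV (S : topologicalType) d (a : S -> R) (b : S -> 'rV[R]_d) :
  continuous a -> continuous b -> continuous (fun s => cons_rV (a s, b s)).
Proof.
move=> ca cb s; apply: cvg_rV => i; rewrite /cons_rV mxE.
under eq_cvg do rewrite mxE; case: unliftP => [k _|_] /=; last exact: ca.
apply: (@continuous_comp _ _ _ b (fun y : 'rV[R]_d => y ord0 k)); first exact: cb.
exact: coord_continuous.
Qed.

(** Haar measure is defined by recursion on the dimension; either order of
    integration is needed, because the coordinate that is differentiated must be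
    integrated first. *)
Lemma haarS_Fubini d (f : 'rV[R]_d.+1 -> R) : continuous f ->
  (\int[haar]_x (f x)%:E =
   \int[uniform_prob (@ltr01 R)]_z \int[haar]_y (f (cons_rV (z, y)))%:E /\
   \int[haar]_x (f x)%:E =
   \int[haar]_y \int[uniform_prob (@ltr01 R)]_z (f (cons_rV (z, y)))%:E)%E.
Proof.
move=> cf; have := continuous_haar_integrable cf => intf.
have mc := @measurable_cons_rV R d.
have mf : measurable_fun setT (EFin \o f).
  by apply/measurable_EFinP; exact: continuous_measurable_rV.
have mfc : measurable_fun setT (fun zy => (f (cons_rV (d:=d) zy))%:E).
  exact: measurableT_comp mf mc.
have intfc : (uniform_prob (@ltr01 R) \x @haar R d)%E.-integrable setT
    (fun zy => (f (cons_rV zy))%:E).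
  apply/integrableP; split=> //; case/integrableP : intf => _.
  suff -> : (\int[uniform_prob (@ltr01 R) \x @haar R d]_zy `|(f (cons_rV zy))%:E| =
      \int[haar]_x `|(f x)%:E|)%E by [].
  symmetry.
  apply: (@ge0_integral_pushforward _ _ _ _ R _ mc
    (uniform_prob (@ltr01 R) \x @haar R d)%E setT (abse \o (EFin \o f))) => //.
    exact: measurableT_comp.
  by move=> x _; rewrite /= lee_fin.
have E : (\int[haar]_x (f x)%:E =
    \int[uniform_prob (@ltr01 R) \x haar]_zy (f (cons_rV zy))%:E)%E.
  exact: (eq_trans _ (integral_pushforward mc mf intfc measurableT)).
split; first by rewrite E -(integral12_prod_meas1 intfc).
by rewrite E -(integral21_prod_meas1 intfc).
Qed.

Lemma is_derive_line d (f : 'rV[R]_d -> R) i (x : 'rV[R]_d) (z : R) :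
  derivable f (z *: Defs.basis R i + x) (Defs.basis R i) ->
  is_derive z (1 : R) (fun s : R => f (s *: Defs.basis R i + x))
    (partial i f (z *: Defs.basis R i + x)).
Proof.
rewrite /partial => df.
have E : (fun h : R => h^-1 *: (f ((h *: (1 : R) + z) *: Defs.basis R i + x)
    - f (z *: Defs.basis R i + x))) =
  (fun h : R => h^-1 *: (f (h *: Defs.basis R i + (z *: Defs.basis R i + x))
    - f (z *: Defs.basis R i + x))).
  by apply/funext => h; rewrite scalerDl scaler1 -addrA.
by split; rewrite /derivable /derive /= E.
Qed.

(** Stokes on the torus.  By induction on the dimension: a derivative in the first
    coordinate integrates to the difference of the values on opposite faces,
    which is zero by periodicity; the other coordinates belong to the
    lower-dimensional factor. *)
Lemma haar_partial d (f : 'rV[R]_d -> R) i : Zperiodic f -> continuous f ->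
  (forall x, derivable f x (Defs.basis R i)) -> continuous (partial i f) ->
  \int[haar]_x partial i f x = 0.
Proof.
elim: d f i => [|d IH] f i pf cf df cdf; first by case: i {df cdf}.
rewrite /Rintegral; have [E1 E2] := haarS_Fubini cdf.
case: (unliftP ord0 i) => [j|] iE; rewrite {}iE {i} in df cdf E1 E2 *.
  rewrite E1 integral0_eq// => z _.
  have cz (g : 'rV[R]_d.+1 -> R) : continuous g -> continuous (fun y => g (cons_rV (z, y))).
    move=> cg y; apply: (@continuous_comp _ _ _ (fun y => cons_rV (z, y)) g); last exact: cg.
    by apply: (@continuous_cons_rV _ _ (cst z) id); [exact: cst_continuous|move=> ?; exact: cvg_id].
  pose fz y := f (cons_rV (z, y)).
  have E h y : fz (h *: Defs.basis R j + y) = f (h *: Defs.basis R (lift ord0 j) + cons_rV (z, y)).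
    by rewrite /fz cons_rV_basisS.
  have dE : partial j fz = fun y => partial (lift ord0 j) f (cons_rV (z, y)).
    by apply/funext => y; rewrite /partial /derive; under eq_fun do rewrite /= E.
  have := IH fz j; rewrite dE => {}IH.
  transitivity ((\int[haar]_y partial (lift ord0 j) f (cons_rV (z, y)))%:E).
    rewrite /Rintegral fineK//; apply: integrable_fin_num => //.
    by apply: continuous_haar_integrable; exact: cz.
  rewrite IH//.
  - move=> y k; rewrite /fz -(pf (cons_rV (z, y)) (row_mx (0 : 'rV_1) k)).
    congr f; apply/rowP => i; case: (unliftP ord0 i) => [l ->|->].
      rewrite cons_rVS !mxE liftK /=; congr (_ + _).
      case: splitP => [a /=|a /=]; first by rewrite (ord1 a).
      by rewrite /bump /= add1n => -[] /val_inj ->.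
    (* the first coordinate is not moved by the lattice vector (0, k) *)
    rewrite cons_rV0 !mxE unlift_none /=.
    case: splitP => [a /= _|a //]; by rewrite mxE addr0.
  - exact: cz.
  - move=> y; rewrite /derivable; under eq_fun do rewrite /= E; exact: df.
  - exact: cz.
rewrite E2 integral0_eq// => y _.
pose G z := f (cons_rV (z, y)).
have GE z : G z = f (z *: Defs.basis R ord0 + cons_rV (0, y)).
  by rewrite cons_rV_basis0 addr0.
have GEf : G = fun z => f (z *: Defs.basis R ord0 + cons_rV (0, y)) by apply/funext.
have cy (g : 'rV[R]_d.+1 -> R) : continuous g -> continuous (fun z => g (cons_rV (z, y))).
  move=> cg z; apply: (@continuous_comp _ _ _ (fun z => cons_rV (z, y)) g); last exact: cg.
  by apply: (@continuous_cons_rV _ _ id (cst y)); [move=> ?; exact: cvg_id|exact: cst_continuous].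
have dG z : is_derive z (1 : R) G (partial ord0 f (cons_rV (z, y))).
  rewrite GEf; have -> : cons_rV (z, y) = z *: Defs.basis R ord0 + cons_rV (0, y).
    by rewrite cons_rV_basis0 addr0.
  exact: is_derive_line.
rewrite integral_uniform01; last exact: cy.
rewrite (@continuous_FTC2 _ _ G)//.
- rewrite -EFinB GE scale1r /G.
  rewrite (_ : Defs.basis R ord0 + _ = cons_rV (0, y) + lattice (delta_mx ord0 ord0)); last first.
    by rewrite addrC; congr (_ + _); apply/rowP => i; rewrite !mxE; case: (_ && _).
  by rewrite pf subrr.
- by apply: continuous_subspaceT; exact: cy.
- split.
  + by move=> z _; case: (dG z).
  + by apply: cvg_at_right_filter; exact: cy.
  + by apply: cvg_at_left_filter; exact: cy.
- by move=> z _; rewrite derive1E; case: (dG z).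
Qed.

End haar_recursion.

(** * Integration by parts on the torus *)

Section torus_calculus.
Context {R : realType} {d : nat}.
Implicit Types (f g w : 'rV[R]_d -> R) (V : 'rV[R]_d -> 'rV[R]_d).

(** Derivability along the axes with continuous partial derivatives; this is the
    regularity in space that a classical solution provides. *)
Definition torus_C1 f := [/\ Zperiodic f, continuous f &
  forall i, (forall x, derivable f x (Defs.basis R i)) /\ continuous (partial i f)].

Lemma Zperiodic_partial f i : Zperiodic f -> Zperiodic (partial i f).
Proof.
by move=> pf x k; rewrite /partial /derive; under eq_fun do rewrite /= addrA !pf.
Qed.

Lemma continuous_mulf (S : topologicalType) (f g : S -> R) :
  continuous f -> continuous g -> continuous (fun x => f x * g x).
Proof. by move=> cf cg x; apply: continuousM; [exact: cf|exact: cg]. Qed.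

Lemma continuous_addf (S : topologicalType) (f g : S -> R) :
  continuous f -> continuous g -> continuous (fun x => f x + g x).
Proof. by move=> cf cg x; apply: continuousD; [exact: cf|exact: cg]. Qed.

Lemma continuous_subf (S : topologicalType) (f g : S -> R) :
  continuous f -> continuous g -> continuous (fun x => f x - g x).
Proof. by move=> cf cg x; apply: continuousB; [exact: cf|exact: cg]. Qed.

Lemma continuous_sumf (I : Type) (r : seq I) (F : I -> 'rV[R]_d -> R) :
  (forall i, continuous (F i)) -> continuous (fun x => \sum_(i <- r) F i x).
Proof.
move=> cF; elim: r => [|i r IH].
  by under eq_fun do rewrite big_nil; exact: cst_continuous.
by under eq_fun do rewrite big_cons; exact: continuous_addf.
Qed.

Lemma haar_sum (I : Type) (r : seq I) (F : I -> 'rV[R]_d -> R) :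
  (forall i, continuous (F i)) ->
  \int[haar]_x (\sum_(i <- r) F i x) = \sum_(i <- r) \int[haar]_x F i x.
Proof.
move=> cF; elim: r => [|i r IH].
  rewrite big_nil; under eq_Rintegral do rewrite big_nil.
  by rewrite Rintegral_cst// mul0r.
rewrite big_cons; under eq_Rintegral do rewrite big_cons.
rewrite RintegralD//; last 2 first.
- exact: continuous_haar_integrable.
- by apply: continuous_haar_integrable; exact: continuous_sumf.
by rewrite IH.
Qed.

Lemma partialM f g i x : derivable f x (Defs.basis R i) ->
  derivable g x (Defs.basis R i) ->
  partial i (fun y => f y * g y) x = f x * partial i g x + partial i f x * g x.
Proof.
by move=> df dg; rewrite /partial [LHS](deriveM df dg) /= [X in _ + X]mulrC.
Qed.

Lemma torus_C1M f g : torus_C1 f -> torus_C1 g -> torus_C1 (fun x => f x * g x).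
Proof.
move=> [pf cf df] [pg cg dg]; split=> [x k||i].
- by rewrite pf pg.
- exact: continuous_mulf.
have [dfi cdf] := df i; have [dgi cdg] := dg i; split=> [x|].
  exact: (derivableM (dfi x) (dgi x)).
rewrite (_ : partial i _ = fun x => f x * partial i g x + partial i f x * g x).
  by apply: continuous_addf; exact: continuous_mulf.
by apply/funext => x; exact: partialM.
Qed.

Lemma torus_C1B f g : torus_C1 f -> torus_C1 g -> torus_C1 (fun x => f x - g x).
Proof.
move=> [pf cf df] [pg cg dg]; split=> [x k||i].
- by rewrite pf pg.
- exact: continuous_subf.
have [dfi cdf] := df i; have [dgi cdg] := dg i; split=> [x|].
  exact: (derivableB (dfi x) (dgi x)).
rewrite (_ : partial i _ = fun x => partial i f x - partial i g x).
  exact: continuous_subf.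
by apply/funext => x; exact: (deriveB (dfi x) (dgi x)).
Qed.

(** The product has zero mean derivative. *)
Lemma haar_by_parts f g i : torus_C1 f -> torus_C1 g ->
  \int[haar]_x (f x * partial i g x) = - \int[haar]_x (partial i f x * g x).
Proof.
move=> Cf Cg; have [pfg cfg dfg] := torus_C1M Cf Cg.
move: Cf Cg => [_ cf df] [_ cg dg].
have [dfi cdf] := df i; have [dgi cdg] := dg i.
have := haar_partial pfg cfg (dfg i).1 (dfg i).2.
rewrite (_ : partial i _ = fun x => f x * partial i g x + partial i f x * g x).
  2: by apply/funext => x; exact: partialM.
rewrite RintegralD//; last 2 first.
- by apply: continuous_haar_integrable; exact: continuous_mulf.
- by apply: continuous_haar_integrable; exact: continuous_mulf.
by move=> /eqP; rewrite addr_eq0 => /eqP.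
Qed.

Lemma haar_divergence w V : torus_C1 w ->
  (forall i, torus_C1 (fun x => V x ord0 i)) ->
  \int[haar]_x (w x * divergence V x) = - \int[haar]_x dot (grad w x) (V x).
Proof.
move=> Cw CV; rewrite /divergence /dot.
under eq_Rintegral do rewrite mulr_sumr.
rewrite !haar_sum; last 2 first.
- move=> i; have [_ cw dw] := Cw; have [_ cV _] := CV i.
  apply: continuous_mulf => //; rewrite /grad; under eq_fun do rewrite mxE.
  exact: (dw i).2.
- move=> i; have [_ cw _] := Cw; have [_ _ dV] := CV i.
  by apply: continuous_mulf => //; exact: (dV i).2.
rewrite -sumrN; apply: eq_bigr => i _; rewrite haar_by_parts//.
by under [in RHS]eq_Rintegral do rewrite mxE.
Qed.

Definition torus_C2 f := torus_C1 f /\ forall i, torus_C1 (partial i f).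

Lemma torus_C2B f g : torus_C2 f -> torus_C2 g -> torus_C2 (fun x => f x - g x).
Proof.
move=> [Cf C2f] [Cg C2g]; split=> [|i]; first exact: torus_C1B.
rewrite (_ : partial i _ = fun x => partial i f x - partial i g x).
  exact: torus_C1B.
apply/funext => x; have [_ _ df] := Cf; have [_ _ dg] := Cg.
exact: (deriveB ((df i).1 x) ((dg i).1 x)).
Qed.

Lemma laplacianB f g x : torus_C2 f -> torus_C2 g ->
  laplacian (fun x => f x - g x) x = laplacian f x - laplacian g x.
Proof.
move=> [[_ _ df] C2f] [[_ _ dg] C2g]; rewrite /laplacian -sumrB.
apply: eq_bigr => i _.
rewrite (_ : partial i (fun y => f y - g y) = fun x => partial i f x - partial i g x).
  have [_ _ d2f] := C2f i; have [_ _ d2g] := C2g i.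
  exact: (deriveB ((d2f i).1 x) ((d2g i).1 x)).
by apply/funext => y; exact: (deriveB ((df i).1 y) ((dg i).1 y)).
Qed.

Lemma gradB f g x : torus_C1 f -> torus_C1 g ->
  grad (fun x => f x - g x) x = grad f x - grad g x.
Proof.
move=> [_ _ df] [_ _ dg]; apply/rowP => i; rewrite !mxE.
exact: (deriveB ((df i).1 x) ((dg i).1 x)).
Qed.

Lemma continuous_laplacian f : torus_C2 f -> continuous (laplacian f).
Proof.
move=> [_ C2f]; apply: continuous_sumf => i; have [_ _ d2f] := C2f i.
exact: (d2f i).2.
Qed.

Lemma haar_laplacian_sym f g : torus_C2 f -> torus_C2 g ->
  \int[haar]_x (laplacian f x * g x) = \int[haar]_x (f x * laplacian g x).
Proof.
move=> [Cf C2f] [Cg C2g]; rewrite /laplacian.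
under eq_Rintegral do rewrite mulr_suml.
under [RHS]eq_Rintegral do rewrite mulr_sumr.
have [_ cf _] := Cf; have [_ cg _] := Cg.
rewrite !haar_sum; last 2 first.
- move=> i; have [_ _ dg] := C2g i.
  by apply: continuous_mulf => //; exact: (dg i).2.
- move=> i; have [_ _ df] := C2f i.
  by apply: continuous_mulf => //; exact: (df i).2.
apply: eq_bigr => i _; rewrite [RHS](haar_by_parts i Cf (C2g i)).
by rewrite (haar_by_parts i (C2f i) Cg) opprK.
Qed.

End torus_calculus.

(** * Functions of time and space *)

Section continuity_within.

Lemma within_continuous_comp (S U V : topologicalType) (A : set U) (f : U -> V)
    (g : S -> U) :
  {within A, continuous f} -> continuous g -> (forall s, A (g s)) ->
  continuous (f \o g).
Proof.
move=> /subspace_continuousP cf cg Ag s; apply: cvg_comp (cf _ (Ag s)) => W /= nW.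
have {}nW : nbhs s (fun t => A (g t) -> W (g t)) := cg s _ nW.
by apply: filterS nW => t AW; exact: AW (Ag t).
Qed.

Lemma continuous_pair (S U V : topologicalType) (f : S -> U) (g : S -> V) :
  continuous f -> continuous g -> continuous (fun s => (f s, g s)).
Proof.
by move=> cf cg s; apply: (cvg_pair (cf s) (cg s)).
Qed.

End continuity_within.

Section time_regularity.
Context {R : realType} {d : nat}.
Variable (T : R).
Let I : set R := `[0, T]%classic.
Let D : set (R * 'rV[R]_d) := I `*` [set: 'rV[R]_d].
Implicit Types (F G : R -> 'rV[R]_d -> R).

(** Freezing the time of a function that is only continuous within [0, T] x R^d. *)
Lemma within_slice F t : 0 <= t <= T ->
  {within D, continuous (fun z => F z.1 z.2)} -> continuous (F t).
Proof.
move=> tI cF; apply: (within_continuous_comp (g := fun x => (t, x)) cF).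
  by apply: continuous_pair; [exact: cst_continuous|move=> ?; exact: cvg_id].
by move=> x; split; rewrite //= in_itv.
Qed.

(** At an interior time the one-sided difference quotients of [C12] are the
    two-sided ones, so the time derivative is a genuine one. *)
Lemma C12_is_derive F : C12 T F -> exists2 Ft : R -> 'rV[R]_d -> R,
  {within D, continuous (fun z => Ft z.1 z.2)} &
  forall t x, 0 < t < T -> is_derive t (1 : R) (F ^~ x) (Ft t x).
Proof.
move=> [_ [Ft cFt dF] _ _]; exists Ft => // t x /andP[t0 tT].
suff cv : (h^-1 *: (F (h *: (1 : R) + t) x - F t x)) @[h --> 0^'] --> Ft t x.
  by split; [apply/cvg_ex; exists (Ft t x)|exact: cvg_lim].
have It : I t by rewrite /I /= in_itv/= !ltW.
apply/cvgrPdist_lt => e e0.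
have := dF t x It; move/cvgrPdist_lt => /(_ e e0).
rewrite near_withinE /= near_withinE => -[r /= r0 rP].
near=> h.
have -> : h^-1 *: (F (h *: 1 + t) x - F t x) =
    (h + t - t)^-1 * (F (h + t) x - F t x).
  by rewrite addrK [h *: 1]mulr1.
have hr : `|h| < Num.min r (Num.min t (T - t)).
  near: h; apply: dnbhs0_lt; rewrite !lt_min r0 t0 subr_gt0 tT//.
move: hr; rewrite !lt_min => /and3P[hr ht hT].
apply: rP.
- by rewrite /= opprD addrCA subrr addr0 normrN.
- by rewrite -subr_eq0 addrK; near: h; exact: nbhs_dnbhs_neq.
- move: ht hT; rewrite !ltr_norml => /andP[? _] /andP[_ ?].
  by rewrite /I /= in_itv/= -lerBlDr sub0r ltW//= -lerBrDr ltW.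
Unshelve. all: by end_near. Qed.

Lemma C12_torus_C2 F t : C12 T F -> 0 <= t <= T -> Zperiodic (F t) ->
  torus_C2 (F t).
Proof.
move=> [cF _ d1F d2F] tI pF.
have It : I t by rewrite /I /= in_itv.
split=> [|i]; split=> [||j].
- exact: pF.
- exact: within_slice.
- have [c1 d1] := d1F j; split=> [x|]; first exact: d1.
  exact: (within_slice (F := fun t => partial j (F t))).
- exact: Zperiodic_partial.
- have [c1 _] := d1F i.
  exact: (within_slice (F := fun t => partial i (F t))).
- have [c1 d1] := d2F i j; split=> [x|]; first exact: d1.
  exact: (within_slice (F := fun t => partial j (partial i (F t)))).
Qed.

Lemma within_bounded F : {within D, continuous (fun z => F z.1 z.2)} ->
  exists2 M : R, 0 <= M & forall t x, 0 <= t <= T -> cube x -> `|F t x| <= M.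
Proof.
move=> cF.
have : compact ((fun z => F z.1 z.2) @` (I `*` @cube R d)).
  apply: continuous_compact.
    by apply: continuous_subspaceW cF => -[t x] /= [].
  by apply: compact_setX; [exact: segment_compact|exact: compact_cube].
move=> /compact_bounded[M [_ Mf]].
exists (Num.max M 0 + 1); first by rewrite addr_ge0// le_max lexx orbT.
move=> t x It Kx; apply: Mf; last by exists (t, x).
by rewrite (@le_lt_trans _ _ (Num.max M 0))// ?ltrDl// le_max lexx.
Qed.

Lemma haar_cubeE (f : 'rV[R]_d -> R) : continuous f ->
  \int[haar]_(x in cube) f x = \int[haar]_x f x.
Proof.
move=> cf; rewrite /Rintegral.
rewrite [in RHS](@negligible_integral _ _ _ _ _ (~` @cube R d))//.
- by rewrite setTD setCK.
- by apply: measurableC; exact: measurable_cube.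
- exact: continuous_haar_integrable.
- exact: haar_cube.
Qed.

Hypothesis T0 : 0 < T.

(** The retraction of the line onto [0, T].  Precomposition with it turns
    continuity within [0, T] into continuity on the whole line. *)
Definition clamp (s : R) := Num.max 0 (Num.min s T).

Lemma clampP s : 0 <= clamp s <= T.
Proof. by rewrite /clamp le_max lexx /= ge_max (ltW T0) ge_min lexx orbT. Qed.

Lemma clamp_id s : 0 <= s <= T -> clamp s = s.
Proof. by move=> /andP[s0 sT]; rewrite /clamp (min_idPl sT) (max_idPr s0). Qed.

Lemma continuous_clamp : continuous clamp.
Proof.
move=> s; apply: (@continuous_max _ _ (cst 0) (fun s => Num.min s T)).
  exact: cst_continuous.
by apply: (@continuous_min _ _ id (cst T)) => //; exact: cst_continuous.
Qed.

Lemma continuous_clamped F x : {within D, continuous (fun z => F z.1 z.2)} ->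
  continuous (fun s => F (clamp s) x).
Proof.
move=> cF; apply: (within_continuous_comp (g := fun s => (clamp s, x)) cF).
  by apply: continuous_pair; [exact: continuous_clamp|exact: cst_continuous].
by move=> s; split=> //=; exact: clampP.
Qed.

(** Differentiation under the integral sign; compactness of [0, T] times the cube
    supplies the constant that dominates the time derivative. *)
Lemma haar_time_derivative F Ft t :
  {within D, continuous (fun z => F z.1 z.2)} ->
  {within D, continuous (fun z => Ft z.1 z.2)} ->
  (forall t x, 0 < t < T -> is_derive t (1 : R) (F ^~ x) (Ft t x)) ->
  0 < t < T ->
  is_derive t (1 : R) (fun s => \int[haar]_x F s x) (\int[haar]_x Ft t x).
Proof.
move=> cF cFt dF tT.
have [M M0 FtM] := within_bounded cFt.
have lI s : s \in `]0, T[ -> 0 <= s <= T.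
  by rewrite in_itv/= => /andP[? ?]; rewrite !ltW.
have mC := @measurable_cube R d.
have It : (`]0, T[%classic : set R) t by rewrite /= in_itv.
have intF s : (`]0, T[%classic : set R) s -> (@haar R d).-integrable (@cube R d) (EFin \o F s).
  move=> Is; apply: (@integrableS _ _ _ _ setT) => //.
  by apply: continuous_haar_integrable; exact: within_slice (lI _ Is) cF.
have intM : (@haar R d).-integrable (@cube R d) (EFin \o (cst M : 'rV[R]_d -> R)).
  apply: (@integrableS _ _ _ _ setT) => //.
  by apply: continuous_haar_integrable; exact: cst_continuous.
have derF s x : (`]0, T[%classic : set R) s -> @cube R d x -> derivable (F ^~ x) s 1.
  by move=> Is _; case: (dF s x Is).
have FM s x : (`]0, T[%classic : set R) s -> @cube R d x -> `|partial1of2 F s x| <= M.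
  move=> Is Kx; rewrite partial1of2E; case: (dF s x Is) => _ ->.
  exact: FtM (lI _ Is) Kx.
have dI := derivable_under_integral mC It intF derF (fun _ => M0) intM FM.
have vI := differentiation_under_integral mC It intF derF (fun _ => M0) intM FM.
have E s : 0 < s < T -> \int[haar]_(x in cube) F s x = \int[haar]_x F s x.
  by move=> Is; apply: haar_cubeE; exact: within_slice (lI _ Is) cF.
apply: (near_eq_is_derive (f := fun s => \int[haar]_(x in cube) F s x)) => //.
  near=> s; apply: E.
  have : s \in `]0, T[ by near: s; apply: near_in_itvoo.
  by rewrite in_itv.
split=> //; rewrite -derive1E vI -[RHS]haar_cubeE; last first.
  exact: within_slice (lI _ It) cFt.
apply: eq_Rintegral => x _; rewrite partial1of2E.
by case: (dF t x tT).
Unshelve. all: by end_near. Qed.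

Lemma haar_time_continuous F :
  {within D, continuous (fun z => F z.1 z.2)} ->
  continuous (fun s => \int[haar]_x F (clamp s) x).
Proof.
move=> cF; have [M M0 FM] := within_bounded cF.
have mC := @measurable_cube R d.
have intF s : (@haar R d).-integrable (@cube R d) (EFin \o F (clamp s)).
  apply: (@integrableS _ _ _ _ setT) => //.
  by apply: continuous_haar_integrable; exact: within_slice (clampP _) cF.
have intM : (@haar R d).-integrable (@cube R d) (EFin \o (cst M : 'rV[R]_d -> R)).
  apply: (@integrableS _ _ _ _ setT) => //.
  by apply: continuous_haar_integrable; exact: cst_continuous.
rewrite (_ : (fun s => _) = fun s => \int[haar]_(x in cube) F (clamp s) x); last first.
  by apply/funext => s; rewrite haar_cubeE//; exact: within_slice (clampP _) cF.
move=> t.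
apply: (@continuity_under_integral R _ _ (@haar R d) (fun s => F (clamp s))
  (@cube R d) mC (t - 1) (t + 1) _ _ (cst M)) => //.
- by apply: aeW => x _ s _; exact: continuous_clamped.
- by move=> s _; apply: aeW => x Kx; apply: FM Kx; exact: clampP.
- by rewrite inE/= in_itv/= ltrDl ltrBlDr ltrDl ltr01.
Qed.

End time_regularity.

(** * Frechet differentials *)

Section differentials.
Context {R : realType} {V W : normedModType R}.
Implicit Types (f : V -> W) (x h : V).

Lemma linear_bound_continuous (L : {linear V -> W}) (C : R) :
  (forall h, `|L h| <= C * `|h|) -> continuous L.
Proof.
move=> LC x; apply/cvgrPdist_lt => e e0.
have C0 : 0 < `|C| + 1 by rewrite ltr_wpDl.
near=> y; rewrite -linearB (le_lt_trans (LC _))//.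
rewrite (@le_lt_trans _ _ ((`|C| + 1) * `|x - y|))//.
  by rewrite ler_wpM2r// (le_trans (ler_norm _))// lerDl.
rewrite -ltr_pdivlMl//; near: y.
move/cvgrPdist_lt : (@cvg_id _ (nbhs x)); apply.
by rewrite mulr_gt0// invr_gt0.
Unshelve. all: by end_near. Qed.

(** The differential is a choice among linear maps; a continuous linear first order
    approximation identifies it. *)
Lemma linear_approx_diff f (L : {linear V -> W}) x : continuous L ->
  (forall e : R, 0 < e -> \forall h \near 0, `|f (x + h) - f x - L h| <= e * `|h|) ->
  differentiable f x /\ 'd f x = L :> (V -> W).
Proof.
move=> cL fL.
have fo : f \o shift x = cst (f x) + L +o_ 0 id.
  apply/eqaddoP => e e0; near=> h.
  rewrite [X in `|X|](_ : _ = f (x + h) - f x - L h).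
    by near: h; exact: fL.
  by rewrite !fctE /= opprD addrA [h + x]addrC.
have dE := diff_unique cL fo.
split=> //; apply/diff_locallyP; split; first by rewrite dE.
by rewrite dE.
Unshelve. all: by end_near. Qed.

(** The differential of a function is zero by convention where the function is
    not differentiable. *)
Lemma diff_neq0_differentiable f x h : 'd f x h != 0 -> differentiable f x.
Proof.
move=> dn0; have [//|nd] := pselect (differentiable f x).
suff d0 : 'd f x h = 0 by rewrite d0 eqxx in dn0.
rewrite /diff xgetPN// => L [cL fL]; apply: nd; apply/diffP.
apply: (@getPex _ (fun (df : {linear V -> W}) => continuous df /\ forall y,
  f y = f (lim (nbhs x)) + df (y - lim (nbhs x)) +o_(y \near x) (y - lim (nbhs x)))).
by exists L.
Qed.

Lemma C1_continuous f : (forall x, differentiable f x) -> continuous f.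
Proof. by move=> df x; exact: differentiable_continuous. Qed.

Lemma C1_diff_continuous f h : C1 f -> continuous (fun x => 'd f x h).
Proof.
move=> [_ cf] x; apply/cvgrPdist_le => e e0.
have h0 : 0 < `|h| + 1 by rewrite ltr_wpDl.
have := cf x _ (divr_gt0 e0 h0); apply: filterS => y /(_ h).
rewrite distrC => /le_trans; apply.
by rewrite mulrAC ler_pdivrMr// ler_wpM2l ?(ltW e0)// lerDl.
Qed.

Lemma diff_bound f x : differentiable f x ->
  exists2 C : R, 0 < C & forall h, `|'d f x h| <= C * `|h|.
Proof. by move=> df; apply: linear_lipschitz; exact: diff_continuous. Qed.

Lemma is_derive_segment f x h (s : R) : differentiable f (x + s *: h) ->
  is_derive s (1 : R) (fun r : R => f (x + r *: h)) ('d f (x + s *: h) h).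
Proof.
move=> df.
have E : (fun r : R => r^-1 *: (f (x + (r *: (1 : R) + s) *: h) - f (x + s *: h))) =
  (fun r : R => r^-1 *: (f (r *: h + (x + s *: h)) - f (x + s *: h))).
  by apply/funext => r; rewrite scalerDl [r *: 1]mulr1 addrCA.
have dv := @diff_derivable _ _ _ _ _ h df.
split; first by rewrite /derivable /= E.
by rewrite /derive /= E -deriveE.
Qed.

End differentials.

Section second_differential.
Context {R : realType} {V : normedModType R}.
Variable F : V -> R.
Hypothesis C2F : C2 F.

(** The third clause of [C2] says that [D2 F v] is the derivative of [ 'd F ] in
    operator norm; here it is evaluated at a fixed direction k. *)
Lemma C2_diff_differentiable (v k : V) :
  differentiable (fun w => 'd F w k : R) v.
Proof.
case: C2F => _ bF dF _; have [C bC] := bF v.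
apply: (linear_approx_diff (L := 'd (fun w => 'd F w k : R) v) _ _).1.
  apply: (@linear_bound_continuous _ _ _ _ (C * `|k|)) => h.
  by rewrite mulrAC; exact: bC.
move=> e e0.
(* the + 1 covers k = 0 *)
have e'0 : 0 < e / (`|k| + 1) by rewrite divr_gt0// ltr_wpDl.
near=> h; apply: (@le_trans _ _ (e / (`|k| + 1) * `|h| * `|k|)).
  by near: h; apply: filterS (dF v _ e'0) => h; apply.
rewrite mulrAC ler_wpM2r// -mulrA ger_pMr// mulrC ler_pdivrMr ?ltr_wpDl//.
by rewrite mul1r lerDl.
Unshelve. all: by end_near. Qed.

Lemma C2_D2_bound v : exists2 C : R, 0 < C &
  forall h k, `|D2 F v h k| <= C * `|h| * `|k|.
Proof.
case: C2F => _ /(_ v)[C bC] _ _; exists (`|C| + 1); first by rewrite ltr_wpDl.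
move=> h k; rewrite (le_trans (bC h k))// ler_wpM2r// ler_wpM2r//.
by rewrite (le_trans (ler_norm _))// lerDl.
Qed.

Lemma C2_C1 : C1 F.
Proof.
case: C2F => dF _ d2F _; split=> // v e e0.
have [C C0 bC] := C2_D2_bound v.
have C1 : 0 < C + 1 by rewrite ltr_wpDl// ltW.
apply/nbhs0P; near=> h => k.
have -> : 'd F (v + h) k - 'd F v k =
    ('d F (v + h) k - 'd F v k - D2 F v h k) + D2 F v h k by rewrite subrK.
apply: (@le_trans _ _ (1 * `|h| * `|k| + C * `|h| * `|k|)).
  rewrite (le_trans (ler_normD _ _))// lerD//.
  by move: (k); near: h; exact: (d2F _ _ ltr01).
rewrite -!mulrDl ler_wpM2r// addrC -ler_pdivlMl// ltW//.
near: h; move/cvgrPdist_lt : (@cvg_id _ (nbhs (0 : V))).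
have e1 : 0 < (C + 1)^-1 * e by rewrite mulr_gt0// invr_gt0.
move=> /(_ _ e1).
by apply: filterS => h; rewrite sub0r normrN.
Unshelve. all: by end_near. Qed.


(** The difference at two points splits into the variation of the direction,
    controlled by the bound on the form at the first point, and the variation of
    the form, controlled by the last clause of [C2]. *)
Lemma C2_D2_continuous (S : topologicalType) (g h : S -> V) (k : V) :
  continuous g -> continuous h -> continuous (fun s => D2 F (g s) (h s) k).
Proof.
case: C2F => _ _ _ cF cg ch s; apply/cvgrPdist_le => e e0.
have [C C0 bC] := C2_D2_bound (g s).
have e2 : 0 < e / 2 by rewrite divr_gt0.
have k0 : 0 < `|k| + 1 by rewrite ltr_wpDl.
have h0 : 0 < `|h s| + 1 by rewrite ltr_wpDl.
have a0 : 0 < e / 2 / (`|k| + 1) / (`|h s| + 1) by rewrite !divr_gt0.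
have b0 : 0 < e / 2 / (`|k| + 1) / C by rewrite !divr_gt0.
have small (x : R) : 0 <= x -> x <= e / 2 / (`|k| + 1) -> x * `|k| <= e / 2.
  move=> x0 xk; rewrite (@le_trans _ _ (x * (`|k| + 1)))//.
    by rewrite ler_wpM2l// lerDl.
  by rewrite -ler_pdivlMr.
have D2r : \forall r \near s, forall h' k', `|D2 F (g r) h' k' - D2 F (g s) h' k'|
    <= e / 2 / (`|k| + 1) / (`|h s| + 1) * `|h'| * `|k'|.
  exact: (cg s _ (cF (g s) _ a0)).
near=> r.
have hr : `|h s - h r| <= Num.min 1 (e / 2 / (`|k| + 1) / C).
  by near: r; move/cvgrPdist_le : (ch s); apply; rewrite lt_min ltr01.
move: hr; rewrite le_min => /andP[hr1 hrC].
have -> : D2 F (g s) (h s) k - D2 F (g r) (h r) k =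
   D2 F (g s) (h s - h r) k - (D2 F (g r) (h r) k - D2 F (g s) (h r) k).
  by rewrite /D2 linearB /= opprB addrA subrK.
rewrite (le_trans (ler_normB _ _))// (splitr e) lerD//.
  rewrite (le_trans (bC _ _))// small ?mulr_ge0 ?(ltW C0)//.
  by rewrite mulrC -ler_pdivlMr.
apply: (@le_trans _ _ (e / 2 / (`|k| + 1) / (`|h s| + 1) * `|h r| * `|k|)).
  by near: r; apply: filterS D2r => r'; apply.
apply: small; first by rewrite mulr_ge0// ltW.
rewrite -mulrA ger_pMr ?divr_gt0//.
rewrite mulrC ler_pdivrMr// mul1r.
rewrite -[h r](subrK (h s)) addrC (le_trans (ler_normD _ _))// lerD//.
by rewrite distrC.
Unshelve. all: by end_near. Qed.

End second_differential.

(** * Differentiability of the averaged Hamiltonian *)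

Lemma haar_norm_le (R : realType) d (f : 'rV[R]_d -> R) (M : R) : continuous f ->
  0 <= M -> (forall x, cube x -> `|f x| <= M) -> `|\int[haar]_x f x| <= M.
Proof.
move=> cf M0 fM; rewrite -haar_cubeE//.
have mC := @measurable_cube R d.
have intf : (@haar R d).-integrable cube (EFin \o f).
  by apply: (@integrableS _ _ _ _ setT) => //; exact: continuous_haar_integrable.
have intM : (@haar R d).-integrable cube (EFin \o (cst M : 'rV[R]_d -> R)).
  apply: (@integrableS _ _ _ _ setT) => //.
  by apply: continuous_haar_integrable; exact: cst_continuous.
rewrite (le_trans (le_normr_Rintegral _ intf))//.
rewrite (@le_trans _ _ (\int[@haar R d]_(x in cube) M))//.
  apply: le_Rintegral => //.
  by rewrite (_ : _ \o _ = abse \o (EFin \o f))//; exact: integrable_abse.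
rewrite Rintegral_cst// -[leRHS]mulr1 ler_wpM2l//.
by rewrite -lee_fin fineK ?fin_num_measure//; exact: probability_le1.
Qed.

Section averaged.
Context {R : realType} {d : nat}.
Let U := (ctorus R d * 'rV[R]_d * 'rV[R]_d)%type.
Variable F : U -> R.
Hypothesis C1F : C1 F.
Variable p : 'rV[R]_d -> 'rV[R]_d.
Hypothesis cp : continuous p.
Implicit Types (m h : ctorus R d).

(** A variation of the density alone. *)
Definition dens_dir h : U := (h, 0, 0).

Lemma norm_dens_dir h : `|dens_dir h| = `|h|.
Proof. by rewrite !prod_normE /= !normr0 -!maxA maxxx; exact/max_idPl/normr_ge0. Qed.

Lemma dens_dirD m h x q : ((m, x, q) : U) + dens_dir h = (m + h, x, q).
Proof. by congr (_, _, _); rewrite /= addr0. Qed.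

Lemma dens_dir_linear (a : R) m h : dens_dir (a *: m + h) = a *: dens_dir m + dens_dir h.
Proof. by congr (_, _, _); rewrite /= scaler0 addr0. Qed.

Lemma continuous_graph m : continuous (fun x : 'rV[R]_d => (m, x, p x) : U).
Proof.
apply: continuous_pair => //; apply: continuous_pair; first exact: cst_continuous.
by move=> ?; exact: cvg_id.
Qed.

(** Continuity of the differential for the operator norm, made uniform in x by
    compactness of the cube. *)
Lemma diff_uniform_on_cube m (e : R) : 0 < e -> \forall h \near (0 : ctorus R d),
  forall x, cube x -> forall k,
    `|'d F (m + h, x, p x) k - 'd F (m, x, p x) k| <= e * `|k|.
Proof.
move=> e0; case: C1F => _ cF.
have tri (a b c r s : R) : `|a - c| <= r -> `|b - c| <= s -> `|a - b| <= r + s.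
  move=> ac bc; have -> : a - b = (a - c) - (b - c) by rewrite opprB addrA subrK.
  by rewrite (le_trans (ler_normB _ _))// lerD.
have e2 : 0 < e / 2 by rewrite divr_gt0.
have /compact_near_coveringP cK := @compact_cube R d.
apply: (cK _ (nbhs (0 : ctorus R d)) (fun h x => forall k,
    `|'d F (m + h, x, p x) k - 'd F (m, x, p x) k| <= e * `|k|)) => x0 _.
have c1 : continuous (fun z : 'rV[R]_d * ctorus R d => (m + z.2, z.1, p z.1) : U).
  apply: continuous_pair; last first.
    move=> z; apply: (@continuous_comp _ _ _ fst p); last exact: cp.
    exact: cvg_fst.
  apply: continuous_pair => z; last exact: cvg_fst.
  by apply: (@continuousD _ _ _ (cst m) snd); [exact: cst_continuous|exact: cvg_snd].
have H1 : \forall x \near x0 & h \near (0 : ctorus R d), forall k,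
    `|'d F (m + h, x, p x) k - 'd F (m, x0, p x0) k| <= e / 2 * `|k|.
  have := c1 (x0, 0) _ (cF _ _ e2).
  by rewrite /= addr0.
have H2 : \forall x \near x0 & h \near (0 : ctorus R d), forall k,
    `|'d F (m, x, p x) k - 'd F (m, x0, p x0) k| <= e / 2 * `|k|.
  have c2 : continuous (fun z : 'rV[R]_d * ctorus R d => (m, z.1, p z.1) : U).
    move=> z; apply: (@continuous_comp _ _ _ fst (fun x => (m, x, p x) : U)).
      exact: cvg_fst.
    exact: continuous_graph.
  exact: (c2 (x0, 0) _ (cF _ _ e2)).
apply: (filterS2 _ _ H1 H2) => -[x h] /= H1z H2z k.
by have := tri _ _ _ _ _ (H1z k) (H2z k); rewrite -mulrDl -splitr.
Qed.

(** Near each point of the cube the operator norm is at most the norm at that point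
    plus one; compactness turns these local bounds into a global one. *)
Lemma diff_bound_on_cube m : exists2 C : R, 0 <= C &
  forall x, cube x -> forall k, `|'d F (m, x, p x) k| <= C * `|k|.
Proof.
case: C1F => dF cF.
have tri (a b r s : R) : `|a - b| <= r -> `|b| <= s -> `|a| <= r + s.
  by move=> ab bs; rewrite -[a](subrK b) (le_trans (ler_normD _ _))// lerD.
have /compact_near_coveringP cK := @compact_cube R d.
have : \forall C \near pinfty_nbhs R, forall x, cube x ->
    forall k, `|'d F (m, x, p x) k| <= C * `|k|.
  apply: (cK R (pinfty_nbhs R) (fun C x => forall k, `|'d F (m, x, p x) k| <= C * `|k|)) => x0 _.
  have [C C0 bC] := diff_bound (dF (m, x0, p x0)).
  have H1 : \forall x \near x0, forall k,
      `|'d F (m, x, p x) k - 'd F (m, x0, p x0) k| <= 1 * `|k|.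
    exact: (@continuous_graph m x0 _ (cF _ _ ltr01)).
  have H2 : filter_prod (nbhs x0) (pinfty_nbhs R) (fun z => forall k,
      `|'d F (m, z.1, p z.1) k - 'd F (m, x0, p x0) k| <= 1 * `|k|).
    exact: (@cvg_fst _ _ (nbhs x0) (pinfty_nbhs R) _ _ H1).
  have H3 : filter_prod (nbhs x0) (pinfty_nbhs R) (fun z => C + 1 <= z.2).
    exact: (@cvg_snd _ _ (nbhs x0) (pinfty_nbhs R) _ _ (nbhs_pinfty_ge (num_real (C + 1)))).
  apply: (filterS2 _ _ H2 H3) => -[x C'] /= H2z H3z k.
  apply: (le_trans (tri _ _ _ _ (H2z k) (bC k))).
  by rewrite -mulrDl ler_wpM2r// addrC.
move=> H; have [C [HC C0]] := filter_ex (filterI H (nbhs_pinfty_ge (num_real (0 : R)))).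
by exists C.
Qed.

(** Mean value theorem on the segment from m to m + h: the error is the variation
    of the differential along it, which is uniformly small on the cube. *)
Lemma taylor_uniform_on_cube m (e : R) : 0 < e -> \forall h \near (0 : ctorus R d),
  forall x, cube x ->
    `|F (m + h, x, p x) - F (m, x, p x) - 'd F (m, x, p x) (dens_dir h)| <= e * `|h|.
Proof.
move=> e0; have := diff_uniform_on_cube m e0.
move=> /nbhs_ballP[r /= r0 rP]; apply/nbhs_ballP; exists r => //= h hr x Kx.
pose f (s : R) := F ((m, x, p x) + s *: dens_dir h).
pose df (s : R) := 'd F ((m, x, p x) + s *: dens_dir h) (dens_dir h).
have fd s : is_derive s (1 : R) f (df s).
  by apply: is_derive_segment; case: C1F.
have cf : {within `[0, 1], continuous f}.
  by apply: derivable_within_continuous => s _; exact: ex_derive.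
have [s s01] := @MVT R f df 0 1 ltr01 (fun s _ => fd s) cf.
have -> : 'd F (m, x, p x) (dens_dir h) = df 0 by rewrite /df scale0r addr0.
rewrite subr0 mulr1 {1}/f {1}/f scale0r addr0 scale1r dens_dirD => ->.
rewrite -(norm_dens_dir h) /df scale0r addr0.
have -> : ((m, x, p x) : U) + s *: dens_dir h = (m + s *: h, x, p x).
  by rewrite -dens_dirD; congr (_ + _); congr (_, _, _); rewrite scaler0.
apply: rP => //.
move: hr; rewrite -!ball_normE /= !sub0r !normrN; apply: le_lt_trans.
move: s01; rewrite in_itv/= => /andP[/ltW s0 /ltW s1].
by rewrite normrZ ger0_norm// ler_piMl.
Qed.

(** [calH D p] is the case of the Hamiltonian of the model. *)
Definition averaged m := \int[haar]_x (m x * F (m, x, p x)).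

Definition averaged_diff m h := \int[haar]_x
  (h x * F (m, x, p x) + m x * 'd F (m, x, p x) (dens_dir h)).

Lemma continuous_along_graph m : continuous (fun x => F (m, x, p x)).
Proof.
move=> x; apply: (@continuous_comp _ _ _ (fun x => (m, x, p x) : U) F).
  exact: continuous_graph.
by apply: C1_continuous; case: C1F.
Qed.

Lemma continuous_diff_along_graph m k : continuous (fun x => 'd F (m, x, p x) k).
Proof.
move=> x; apply: (@continuous_comp _ _ _ (fun x => (m, x, p x) : U) (fun v => 'd F v k)).
  exact: continuous_graph.
exact: C1_diff_continuous.
Qed.

Lemma continuous_averaged_diff_integrand m h : continuous
  (fun x => h x * F (m, x, p x) + m x * 'd F (m, x, p x) (dens_dir h)).
Proof.
apply: continuous_addf; apply: continuous_mulf; try exact: ctorus_continuous.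
- exact: continuous_along_graph.
- exact: continuous_diff_along_graph.
Qed.

Lemma averaged_diff_linear m : linear (averaged_diff m : _ -> R^o).
Proof.
move=> a h k; rewrite /averaged_diff.
have I h := continuous_haar_integrable (@continuous_averaged_diff_integrand m h).
rewrite -[X in _ = X + _]RintegralZl// -RintegralD//; last first.
  by apply: continuous_haar_integrable; apply: continuous_mulf;
    [exact: cst_continuous|exact: continuous_averaged_diff_integrand].
apply: eq_Rintegral => x _; rewrite dens_dir_linear linearD linearZ.
rewrite [(a *: h + k : ctorus R d) x](_ : _ = a * h x + k x)//.
have key (b c f hx kx mx : R) : (a * hx + kx) * f + mx * (a * b + c) =
    a * (hx * f + mx * b) + (kx * f + mx * c) by ring.
exact: key.
Qed.

(** With a, b, c the values at x of F(m + h), F(m) and the differential in the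
    direction h, the remainder of the integrand is m (a - b - c) + h (a - b).  The
    first term is small by the uniform Taylor estimate, the second is quadratic
    in h. *)
Lemma averaged_differentiable m :
  differentiable averaged m /\ 'd averaged m = averaged_diff m :> (_ -> _).
Proof.
have [C C0 bC] := diff_bound_on_cube m.
have [B B0 bB] := continuous_bounded_cube (@continuous_along_graph m).
pose L : {linear ctorus R d -> R} := HB.pack (averaged_diff m)
  (GRing.isLinear.Build R (ctorus R d) R *:%R (averaged_diff m) (averaged_diff_linear m)).
apply: (linear_approx_diff (L := L)).
  apply: (@linear_bound_continuous _ _ _ L (B + `|m| * C)) => h.
  apply: haar_norm_le; first exact: continuous_averaged_diff_integrand.
    by rewrite mulr_ge0// addr_ge0// mulr_ge0.
  move=> x Kx; rewrite (le_trans (ler_normD _ _))// mulrDl lerD// normrM.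
    by rewrite mulrC ler_pM// ?bB//; exact: ctorus_norm_ub.
  rewrite -mulrA ler_pM//; first exact: ctorus_norm_ub.
  by rewrite -(norm_dens_dir h) bC.
move=> e e0.
pose e1 := e / 2 / (`|m| + 1).
have m0 : 0 < `|m| + 1 by rewrite ltr_wpDl.
have e2 : 0 < e / 2 by rewrite divr_gt0.
have e10 : 0 < e1 by rewrite divr_gt0.
near=> h.
have ht x : cube x ->
    `|F (m + h, x, p x) - F (m, x, p x) - 'd F (m, x, p x) (dens_dir h)| <= e1 * `|h|.
  by move: x; near: h; exact: taylor_uniform_on_cube.
(* makes the quadratic term h (a - b) smaller than e |h| / 2 *)
have hs : (C + e1) * `|h| <= e / 2.
  rewrite -ler_pdivlMl ?ltr_wpDl//; near: h.
  move/cvgrPdist_le : (@cvg_id _ (nbhs (0 : ctorus R d))).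
  have c0 : 0 < (C + e1)^-1 * (e / 2) by rewrite mulr_gt0// invr_gt0 ltr_wpDl.
  by move=> /(_ _ c0); apply: filterS => h; rewrite sub0r normrN.
have cI (k : ctorus R d) : continuous (fun x => k x * F (k, x, p x)).
  by apply: continuous_mulf; [exact: ctorus_continuous|exact: continuous_along_graph].
have -> : averaged (m + h) - averaged m - L h = \int[haar]_x
    ((m + h) x * F (m + h, x, p x) - m x * F (m, x, p x) -
    (h x * F (m, x, p x) + m x * 'd F (m, x, p x) (dens_dir h))).
  rewrite RintegralB//; last 2 first.
  - by apply: continuous_haar_integrable; apply: continuous_subf; exact: cI.
  - by apply: continuous_haar_integrable; exact: continuous_averaged_diff_integrand.
  by rewrite RintegralB//; apply: continuous_haar_integrable; exact: cI.
apply: haar_norm_le.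
- apply: continuous_subf; last exact: continuous_averaged_diff_integrand.
  by apply: continuous_subf; exact: cI.
- by rewrite mulr_ge0// ltW.
move=> x Kx; rewrite ctorusD.
have := ht x Kx; have := bC x Kx (dens_dir h); rewrite norm_dens_dir.
move: (F (m + h, x, p x)) (F (m, x, p x)) ('d F (m, x, p x) (dens_dir h)) => a b c cb abc.
have -> : (m x + h x) * a - m x * b - (h x * b + m x * c) =
  m x * (a - b - c) + h x * (a - b).
  by ring.
have ab : `|a - b| <= (C + e1) * `|h|.
  rewrite -[a - b](subrK c) (le_trans (ler_normD _ _))// mulrDl addrC lerD//.
rewrite (le_trans (ler_normD _ _))// (splitr e) mulrDl lerD// normrM.
  apply: (@le_trans _ _ (`|m| * (e1 * `|h|))).
    by rewrite ler_pM//; exact: ctorus_norm_ub.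
  rewrite mulrA ler_wpM2r// /e1 mulrCA ger_pMr// ler_pdivrMr// mul1r.
  by rewrite lerDl.
rewrite mulrC ler_pM//; last exact: ctorus_norm_ub.
exact: le_trans hs.
Unshelve. all: by end_near. Qed.

End averaged.

(** * Convexity, concavity and one-sided derivatives *)

Section convexity.
Context {R : realType} {V : normedModType R}.

(** Along the segment f has the derivative psi, whose own derivative is the second
    differential and hence positive; so the mean slope psi(c) exceeds psi(0). *)
Lemma D2_gt0_convex (f : V -> R) x h : (forall v, differentiable f v) ->
  (forall s : R, 0 <= s <= 1 -> 0 < D2 f (x + s *: h) h h) ->
  f x + 'd f x h < f (x + h).
Proof.
move=> df d2f.
pose phi (s : R) := f (x + s *: h).
pose psi (s : R) := 'd f (x + s *: h) h.
have dphi (s : R) : is_derive s (1 : R) phi (psi s) by apply: is_derive_segment.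
have dpsi (s : R) : 0 <= s <= 1 ->
    is_derive s (1 : R) psi (D2 f (x + s *: h) h h).
  move=> s01; apply: (is_derive_segment (f := fun w => 'd f w h : R)).
  by apply: diff_neq0_differentiable; apply/lt0r_neq0/d2f.
have cphi : {within `[0, 1], continuous phi}.
  by apply: derivable_within_continuous => s _; exact: ex_derive.
have [c] := MVT ltr01 (fun s _ => dphi s) cphi.
rewrite in_itv/= subr0 mulr1 => /andP[c0 c1] phic.
have c01 (s : R) : s \in `[0, c] -> 0 <= s <= 1.
  by rewrite in_itv/= => /andP[-> /le_trans]; apply; exact: ltW.
have cpsi : {within `[0, c], continuous psi}.
  by apply: derivable_within_continuous => s sc; case: (dpsi s (c01 _ sc)).
have [|c' c'0 psic] := @MVT R psi (fun s => D2 f (x + s *: h) h h) 0 c c0 _ cpsi.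
  move=> s sc; apply: dpsi; apply: c01.
  by move: sc; rewrite !in_itv/= => /andP[/ltW -> /ltW ->].
have : 0 < psi c - psi 0.
  rewrite psic subr0 mulr_gt0// d2f// c01//.
  by move: c'0; rewrite !in_itv/= => /andP[/ltW -> /ltW ->].
rewrite -phic /phi /psi scale0r scale1r addr0 subr_gt0.
by rewrite ltrBrDl.
Qed.

End convexity.

Section right_derivative.
Context {R : realType}.
Implicit Types (f : R -> R) (a l : R).

(** Stated to the right of a only, because it is used at end points of intervals and
    at one-sided maxima. *)
Lemma is_derive_expansion f a l (e : R) : is_derive a (1 : R) f l -> 0 < e ->
  exists2 r : R, 0 < r &
    forall h, 0 < h < r -> `|f (a + h) - f a - l * h| <= e * h.
Proof.
move=> [df dE] e0.
have : (h^-1 *: (f (h *: (1 : R) + a) - f a)) @[h --> 0^'] --> l.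
  by rewrite -dE; exact: df.
move/cvgrPdist_le => /(_ e e0)[r /= r0 rP]; exists r => // h /andP[h0 hr].
have := rP h; rewrite /= sub0r normrN gtr0_norm// (gt_eqF h0) => /(_ hr isT).
rewrite [h *: (1 : R)]mulr1 [h + a]addrC distrC => H.
have -> : f (a + h) - f a - l * h = (h^-1 *: (f (a + h) - f a) - l) * h.
  by rewrite mulrBl [_^-1 *: _]mulrC divfK ?gt_eqF.
by rewrite normrM (gtr0_norm h0) ler_wpM2r// ltW.
Qed.

Lemma is_derive_right_ge f a l (b c : R) : is_derive a (1 : R) f l -> 0 < b ->
  (forall h, 0 < h < b -> f a + c * h <= f (a + h)) -> c <= l.
Proof.
move=> df b0 fc; rewrite leNgt; apply/negP => lc.
have e0 : 0 < (c - l) / 2 by rewrite divr_gt0// subr_gt0.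
have [r r0 rP] := is_derive_expansion df e0.
pose h := Num.min r b / 2.
have m0 : 0 < Num.min r b by rewrite lt_min r0.
have h0 : 0 < h by rewrite divr_gt0.
have hm : h < Num.min r b by rewrite ltr_pdivrMr// ltr_pMr// ltr1n.
have := hm; rewrite lt_min => /andP[hr hb].
have := rP h; rewrite h0 hr => /(_ isT).
have := fc h; rewrite h0 hb => /(_ isT).
have : 0 < (c - l) / 2 * h by rewrite mulr_gt0.
by rewrite ler_norml => ? ? /andP[]; lra.
Qed.

End right_derivative.

Section concavity.
Context {R : realType} {d : nat}.

(** A chord issued from p has at most the slope of the tangent.  Strictness is
    gained at the midpoint: F lies strictly above the chord there, and the
    tangent lies above F. *)
Lemma strictly_concave_tangent (F : 'rV[R]_d -> R) p v (l : R) :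
  strictly_concave F -> is_derive (0 : R) (1 : R) (fun s : R => F (p + s *: v)) l ->
  v != 0 -> F (p + v) < F p + l.
Proof.
move=> cF dFl v0.
have chord (s t : R) : 0 < s < 1 -> 0 < t ->
    s * F (p + t *: v) + (1 - s) * F p < F (p + (s * t) *: v).
  move=> s01 t0; have -> : p + (s * t) *: v = s *: (p + t *: v) + (1 - s) *: p.
    by apply/rowP => i; rewrite !mxE; ring.
  apply: cF => //; rewrite -subr_eq0 [p + _]addrC addrK scaler_eq0 negb_or v0.
  by rewrite (gt_eqF t0).
(* the slope of a chord is at most the derivative *)
have slope t : 0 < t -> F (p + t *: v) - F p <= t * l.
  move=> t0; rewrite mulrC -ler_pdivrMr//.
  apply: (is_derive_right_ge dFl t0) => h /andP[h0 ht].
  have h01 : 0 < h / t < 1 by rewrite divr_gt0//= ltr_pdivrMr// mul1r.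
  have := chord _ _ h01 t0; rewrite divfK ?gt_eqF// => /ltW.
  rewrite add0r scale0r addr0; apply: le_trans.
  by rewrite le_eqVlt; apply/orP; left; apply/eqP; field; rewrite gt_eqF.
(* strictness, from the slope of the chord to the midpoint *)
have h2 : 0 < (1 / 2 : R) < 1 by apply/andP; split; lra.
have := chord (1 / 2) 1 h2 ltr01; have := slope (1 / 2).
rewrite mulr1 scale1r => /(_ (andP h2).1); lra.
Qed.

End concavity.

Section chain_rule.
Context {R : numFieldType} {V W W' : normedModType R}.

Lemma derive_lineE (U : normedModType R) (f : V -> U) x v :
  'D_v f x = 'D_1 (fun h : R => f (h *: v + x)) 0.
Proof.
rewrite /derive; set g1 := fun h => h^-1 *: _; set g2 := fun h => h^-1 *: _.
suff -> : g1 = g2 by [].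
by rewrite funeqE /g1 /g2 => h /=; rewrite addr0 scale0r add0r [_%:A]mulr1.
Qed.

(** Chain rule for an outer map that is differentiable and an inner map that is
    only derivable in the direction v. *)
Lemma is_derive_compose (G : W -> W') (g : V -> W) x v : derivable g x v ->
  differentiable G (g x) ->
  is_derive x v (fun y => G (g y)) ('d G (g x) ('D_v g x)).
Proof.
move=> dg dG; pose l h := g (h *: v + x).
have dl : differentiable l (0 : R).
  by apply: (proj1 (derivable1_diffP _ _)); exact: (proj1 (derivable1P _ _ _)).
have l0 : l 0 = g x by rewrite /l scale0r add0r.
have dGl : differentiable G (l 0) by rewrite l0.
have dc : differentiable (G \o l) (0 : R) by exact: differentiable_comp.
split.
  apply: (proj2 (derivable1P _ _ _)); exact: (proj2 (derivable1_diffP _ _) dc).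
have -> : 'D_v (fun y => G (g y)) x = 'D_1 (G \o l) 0 := derive_lineE _ _ _.
rewrite (deriveE _ dc) diff_comp//= -(deriveE _ dl) l0.
by rewrite -(derive_lineE g).


Qed.

Lemma is_derive_pair (f : V -> W) (g : V -> W') x v :
  derivable f x v -> derivable g x v ->
  is_derive x v (fun y => (f y, g y)) ('D_v f x, 'D_v g x).
Proof.
move=> df dg.
have c : (h^-1 *: ((f (h *: v + x), g (h *: v + x)) - (f x, g x))) @[h --> 0^']
    --> ('D_v f x, 'D_v g x) by exact: (cvg_pair df dg).
by split; [apply/cvg_ex; exists ('D_v f x, 'D_v g x)|exact: cvg_lim].
Qed.

End chain_rule.

(** * The velocity field *)

Section velocity.
Context {R : realType} {d : nat}.
Let U := (ctorus R d * 'rV[R]_d * 'rV[R]_d)%type.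
Variable F : U -> R.
Hypothesis C2F : C2 F.
Implicit Types (m : ctorus R d) (x q v : 'rV[R]_d).

Let dF w : differentiable F w.
Proof. by case: C2F. Qed.

Lemma is_derive_momentum m x q v :
  is_derive q v (fun q' => F (m, x, q')) ('d F (m, x, q) (0, 0, v)).
Proof.
have d0 : derivable (fun _ : 'rV[R]_d => (m, x)) q v by exact: derivable_cst.
have di : derivable (id : 'rV[R]_d -> 'rV[R]_d) q v by exact: derivable_id.
have [dg gE] := is_derive_pair d0 di.
have -> : (0, 0, v) = 'D_v (fun q' : 'rV[R]_d => ((m, x), q') : U) q.
  by rewrite gE derive_id derive_cst.
exact: (is_derive_compose (G := F) dg).
Qed.

Lemma partial_momentum m x q i :
  partial i (fun q' => F (m, x, q')) q = 'd F (m, x, q) (0, 0, Defs.basis R i).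
Proof. by rewrite /partial; case: (is_derive_momentum m x q (Defs.basis R i)). Qed.

(** The gradient in p is given by partial derivatives; differentiability of F makes
    its scalar products the differential in the momentum. *)
Lemma dot_grad_momentum m x q v :
  dot (grad (fun q' => F (m, x, q')) q) v = 'd F (m, x, q) (0, 0, v).
Proof.
rewrite /dot [in RHS](row_sum_delta v).
have E (r : seq 'I_d) : ((0, 0, \sum_(i <- r) v ord0 i *: delta_mx ord0 i) : U) =
    \sum_(i <- r) v ord0 i *: ((0, 0, Defs.basis R i) : U).
  elim: r => [|i r IH]; first by rewrite !big_nil.
  by rewrite !big_cons -IH; congr (_, _, _); rewrite /= scaler0 addr0.
rewrite E linear_sum; apply: eq_bigr => i _.
by rewrite linearZ /grad mxE partial_momentum mulrC.
Qed.

Lemma is_derive_momentum_line m x q v :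
  is_derive (0 : R) (1 : R) (fun s : R => F (m, x, q + s *: v))
    (dot (grad (fun q' => F (m, x, q')) q) v).
Proof.
rewrite dot_grad_momentum.
have dF0 : differentiable F ((m, x, q) + (0 : R) *: ((0, 0, v) : U)) by exact: dF.
have := is_derive_segment dF0; rewrite scale0r addr0.
suff -> : (fun s : R => F ((m, x, q) + s *: ((0, 0, v) : U))) =
    (fun s : R => F (m, x, q + s *: v)) by [].
by apply/funext => s; congr F; congr (_, _, _); rewrite /= scaler0 addr0.
Qed.

Lemma continuous_velocity m (p : 'rV[R]_d -> 'rV[R]_d) i : continuous p ->
  continuous (fun y => partial i (fun q => F (m, y, q)) (p y)).
Proof.
move=> cp; under eq_fun do rewrite partial_momentum.
by apply: continuous_diff_along_graph => //; exact: C2_C1.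
Qed.

(** The velocity D_pH[m](y, p(y)) may be integrated by parts as soon as p may be:
    by the chain rule its derivatives are values of the second differential of F,
    which depends continuously on the base point. *)
Lemma torus_C1_velocity m (p : 'rV[R]_d -> 'rV[R]_d) i :
  (forall y k q, F (m, y + lattice k, q) = F (m, y, q)) ->
  (forall j, torus_C1 (fun y => p y ord0 j)) ->
  torus_C1 (fun y => partial i (fun q => F (m, y, q)) (p y)).
Proof.
move=> pF Cp.
have cp : continuous p by apply: continuous_rV => j; have [] := Cp j.
have pp : Zperiodic p by move=> y k; apply/rowP => j; have [ppj _ _] := Cp j; exact: ppj.
split=> [y k||j].
- rewrite pp; congr (partial i _ _); apply/funext => q; exact: pF.
- exact: continuous_velocity.
pose G w : R := 'd F w (0, 0, Defs.basis R i).
have vE : (fun y => partial i (fun q => F (m, y, q)) (p y)) =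
    fun y => G (m, y, p y).
  by apply/funext => y; rewrite partial_momentum.
pose g y : U := (m, y, p y).
pose dp y : 'rV[R]_d := \row_l partial j (fun y => p y ord0 l) y.
have dpj y : is_derive y (Defs.basis R j) p (dp y).
  have dpy : derivable p y (Defs.basis R j).
    apply/derivable_mxP => a b; rewrite (ord1 a).
    by have [_ _ dpb] := Cp b; exact: (dpb j).1.
  split=> //; rewrite derive_mx//; apply/rowP => l; by rewrite !mxE.
have dg y : is_derive y (Defs.basis R j) g (0, Defs.basis R j, dp y).
  have d0 : derivable (fun _ : 'rV[R]_d => m) y (Defs.basis R j) by exact: derivable_cst.
  have di : derivable (id : 'rV[R]_d -> 'rV[R]_d) y (Defs.basis R j) by exact: derivable_id.
  have [d1 E1] := is_derive_pair d0 di.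
  have [d2 E2] := dpj y.
  have [d3 E3] := is_derive_pair d1 d2.
  by split=> //; rewrite E3 E1 E2 derive_id derive_cst.
(* along the graph of p the differential of F varies by its second differential *)
have dG y : is_derive y (Defs.basis R j) (fun y => G (g y))
    (D2 F (g y) (0, Defs.basis R j, dp y) (0, 0, Defs.basis R i)).
  have [d1 <-] := dg y.
  have dGg : differentiable G (g y) by exact: C2_diff_differentiable.
  exact (is_derive_compose d1 dGg).
rewrite vE; split=> [y|]; first by case: (dG y).
have -> : partial j (fun y => G (m, y, p y)) = fun y =>
    D2 F (g y) (0, Defs.basis R j, dp y) (0, 0, Defs.basis R i).
  by apply/funext => y; case: (dG y).
apply: C2_D2_continuous => //; first exact: continuous_graph.
apply: continuous_pair; first exact: cst_continuous.
apply: continuous_rV => l; rewrite /dp; under eq_fun do rewrite mxE.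
by have [_ _ dpl] := Cp l; exact: (dpl j).2.
Qed.

End velocity.

(** * Essentially bounded kernels and Frechet derivatives on L^1 *)

Section essentially_bounded.
Context {R : realType} {d : nat}.
Implicit Types (f k : 'rV[R]_d -> R).

Lemma ae_cube : {ae @haar R d, forall x, cube x}.
Proof.
exists (~` cube); split => //; last exact: haar_cube.
by apply: measurableC; exact: measurable_cube.
Qed.

(** Essential bounds suffice for integrability because Haar measure is finite. *)
Lemma ae_bounded_integral f (C : R) : measurable_fun setT f -> 0 <= C ->
  {ae @haar R d, forall y, `|f y| <= C} -> (\int[haar]_y `|(f y)%:E| <= C%:E)%E.
Proof.
move=> mf C0 fC.
apply: (@le_trans _ _ (\int[@haar R d]_y (cst C%:E y))%E).
  apply: ae_ge0_le_integral => //.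
  - by apply: measurableT_comp => //; exact/measurable_EFinP.
  - by move: fC; apply: filterS => y fy _; rewrite /= lee_fin.
rewrite integral_cst// [X in (_ * X)%E](_ : _ = 1%E) ?mule1//.
exact: probability_setT.
Qed.

Lemma ae_bounded_integrable f (C : R) : measurable_fun setT f -> 0 <= C ->
  {ae @haar R d, forall y, `|f y| <= C} -> (@haar R d).-integrable setT (EFin \o f).
Proof.
move=> mf C0 fC; apply/integrableP; split; first exact/measurable_EFinP.
by rewrite (le_lt_trans (ae_bounded_integral mf C0 fC))// ltry.
Qed.

Lemma normLinf_ae f (C : R) : (normLinf f <= C%:E)%E ->
  {ae @haar R d, forall y, `|f y| <= C}.
Proof.
rewrite /normLinf unlock /Lnorm ifT; last first.
  by rewrite [X in (_ < X)%E](_ : _ = 1%E)//; exact: probability_setT.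
move=> /ess_supP.
by apply: filterS => y; rewrite /= lee_fin.
Qed.

Lemma Lfun_measurable (p : \bar R) f : f \in Lfun (@haar R d) p ->
  measurable_fun setT f.
Proof. by rewrite inE => /andP[/[!inE]]. Qed.

Lemma Linf_ae_bounded f : f \in Lfun (@haar R d) +oo%E ->
  exists2 C : R, 0 <= C & {ae @haar R d, forall y, `|f y| <= C}.
Proof.
rewrite inE => /andP[_ /[!inE]/=]; rewrite /finite_norm => foo.
have ffin : ('N[@haar R d]_+oo[EFin \o f])%E \is a fin_num.
  by rewrite ge0_fin_numE// Lnorm_ge0.
exists (fine ('N[@haar R d]_+oo[EFin \o f])%E); first exact/fine_ge0/Lnorm_ge0.
by apply: normLinf_ae; rewrite fineK.
Qed.

Lemma ctorus_ae_bounded_mul k (mu : ctorus R d) (C : R) :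
  {ae @haar R d, forall y, `|k y| <= C} ->
  {ae @haar R d, forall y, `|k y * mu y| <= C * `|mu|}.
Proof.
apply: filterS => y ky; rewrite normrM ler_pM//; exact: ctorus_norm_ub.
Qed.

Lemma measurable_ctorus (mu : ctorus R d) : measurable_fun setT mu.
Proof. by apply: continuous_measurable_rV; exact: ctorus_continuous. Qed.

Lemma Linf_mul_integrable k (mu : ctorus R d) : k \in Lfun (@haar R d) +oo%E ->
  (@haar R d).-integrable setT (EFin \o (fun y => k y * mu y)).
Proof.
move=> kL; have [C C0 kC] := Linf_ae_bounded kL.
apply: (@ae_bounded_integrable _ (C * `|mu|)).
- apply: measurable_funM; first exact: Lfun_measurable kL.
  exact: measurable_ctorus.
- by rewrite mulr_ge0.
- exact: ctorus_ae_bounded_mul.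
Qed.

Lemma continuous_Lfun1 f : continuous f -> f \in Lfun (@haar R d) 1.
Proof. by move=> cf; apply/Lfun1_integrable; exact: continuous_haar_integrable. Qed.

(** A continuous function is an admissible variation in L^1, so the L^1 derivative
    gives directional derivatives along continuous functions. *)
Lemma frechet_L1_is_derive (Psi : ('rV[R]_d -> R) -> R) m k (mu : ctorus R d) :
  frechet_L1 Psi m k ->
  is_derive (0 : R) (1 : R) (fun s : R => Psi (m \+ (fun y => s * mu y)))
    (\int[haar]_y (k y * mu y)).
Proof.
move=> [kL Pk].
have cmu := @ctorus_continuous R d mu.
have cmus (s : R) : continuous (fun y => s * mu y).
  by apply: continuous_mulf => //; exact: cst_continuous.
pose N := \int[@haar R d]_y `|mu y|.
have N0 : 0 <= N by apply: Rintegral_ge0 => *; exact: normr_ge0.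
have N1 : 0 < N + 1 by rewrite ltr_wpDl.
have nE (s : R) : normL1 (fun y => s * mu y) = (`|s| * N)%:E.
  rewrite /normL1 Lnorm1 /N.
  have cs : continuous (fun y => `|s * mu y|).
    by move=> y; exact: (cvg_norm (cmus s y)).
  have cn : continuous (fun y => `|mu y|).
    by move=> y; exact: (cvg_norm (cmu y)).
  rewrite -RintegralZl//; last exact: continuous_haar_integrable.
  under eq_Rintegral do rewrite -normrM.
  rewrite /Rintegral fineK//.
  by apply: integrable_fin_num => //; exact: continuous_haar_integrable.
have c : (h^-1 *: (Psi (m \+ (fun y => (h *: (1 : R) + 0) * mu y)) -
    Psi (m \+ (fun y => (0 : R) * mu y)))) @[h --> 0^'] --> \int[haar]_y (k y * mu y).
  rewrite (_ : m \+ (fun y => 0 * mu y) = m); last first.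
    by apply/funext => y; rewrite /= mul0r addr0.
  apply/cvgrPdist_le => e e0.
  have [delta delta0 dP] := Pk (e / (N + 1)) (divr_gt0 e0 N1).
  near=> h.
  have h0 : h != 0 by near: h; exact: nbhs_dnbhs_neq.
  have hd : `|h| < delta / (N + 1).
    by near: h; apply: dnbhs0_lt; rewrite divr_gt0.
  rewrite [h *: (1 : R)]mulr1 addr0.
  have hmuL : (fun y => h * mu y) \in Lfun (@haar R d) 1.
    exact: continuous_Lfun1.
  have := dP _ hmuL; rewrite nE lte_fin.
  have -> : `|h| * N < delta.
    rewrite (@le_lt_trans _ _ (`|h| * (N + 1)))//.
      by rewrite ler_wpM2l// lerDl.
    by rewrite -ltr_pdivlMr.
  move=> /(_ isT); rewrite -EFinM lee_fin.
  have -> : \int[haar]_y (k y * (h * mu y)) = h * \int[haar]_y (k y * mu y).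
    rewrite -RintegralZl//; last exact: Linf_mul_integrable.
    by apply: eq_Rintegral => y _; rewrite mulrCA.
  move=> Pe; rewrite distrC.
  set q := _ - Psi m in Pe *; set I := \int[haar]_y _ in Pe *.
  have -> : h^-1 *: q - I = h^-1 * (q - h * I) by rewrite mulrBr mulKf.
  rewrite normrM normfV ler_pdivrMl ?normr_gt0// (le_trans Pe)//.
  rewrite mulrCA ler_wpM2l// mulrAC ler_pdivrMr// ler_wpM2l ?(ltW e0)//.
  by rewrite lerDl.
by split; [apply/cvg_ex; exists (\int[haar]_y (k y * mu y))|exact: cvg_lim].
Unshelve. all: by end_near. Qed.

End essentially_bounded.

Section locally_bounded.
Context {R : realType} {d : nat}.
Let V := ('rV[R]_d * 'rV[R]_d)%type.
Variable K : V -> 'rV[R]_d -> R.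
Hypothesis CK : C1_Linf K.

(** A direction h in a finite dimensional space is a combination of basis vectors,
    so DK v h is bounded, for small h, by finitely many essential bounds; only
    finitely many null sets are discarded. *)
Lemma C1_Linf_near (v : V) : exists C : R, \forall w \near v,
  {ae @haar R d, forall y, `|K w y| <= C}.
Proof.
have [KL [DK [DKL DKlin DKd _]]] := CK.
have [C0 C00 KC0] := Linf_ae_bounded (KL v).
have DK0 y : DK v 0 y = 0.
  have := DKlin v 1 0 0 y; rewrite scaler0 addr0 mul1r => /eqP.
  by rewrite -subr_eq0 opprD addrA subrr sub0r oppr_eq0 => /eqP.
(* linearity of DK v holds pointwise in y, without exceptional null sets *)
have DKsum (r : seq 'I_d) (a : 'I_d -> R) (b : 'I_d -> V) y :
    DK v (\sum_(i <- r) a i *: b i) y = \sum_(i <- r) a i * DK v (b i) y.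
  by elim: r => [|i r IH]; rewrite ?big_nil// !big_cons DKlin IH.
pose b1 i : V := (Defs.basis R i, 0); pose b2 i : V := (0, Defs.basis R i).
have B i : exists C : R, {ae @haar R d, forall y, `|DK v (b1 i) y| <= C} /\
    {ae @haar R d, forall y, `|DK v (b2 i) y| <= C}.
  have [C C' H] := Linf_ae_bounded (DKL v (b1 i)).
  have [D D' H2] := Linf_ae_bounded (DKL v (b2 i)).
  exists (Num.max C D); split.
    by apply: filterS H => y Hy; rewrite le_max Hy.
  by apply: filterS H2 => y Hy; rewrite le_max Hy orbT.
pose c i := sval (cid (B i)).
have bE (h : V) : h = \sum_i h.1 ord0 i *: b1 i + (\sum_i h.2 ord0 i *: b2 i).
  have E1 (r : seq 'I_d) (a : 'I_d -> R) : \sum_(i <- r) a i *: b1 i =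
      (\sum_(i <- r) a i *: Defs.basis R i, 0).
    elim: r => [|i r IH]; rewrite ?big_nil// !big_cons IH.
    by congr (_, _); rewrite /= scaler0 addr0.
  have E2 (r : seq 'I_d) (a : 'I_d -> R) : \sum_(i <- r) a i *: b2 i =
      (0, \sum_(i <- r) a i *: Defs.basis R i).
    elim: r => [|i r IH]; rewrite ?big_nil// !big_cons IH.
    by congr (_, _); rewrite /= scaler0 addr0.
  rewrite E1 E2; case: h => h1 h2; congr (_, _) => /=.
    by rewrite addr0 [LHS]row_sum_delta.
  by rewrite add0r [LHS]row_sum_delta.
exists (C0 + (1 + (\sum_i c i + \sum_i c i))).
apply/nbhs0P.
have h1 : \forall h \near (0 : V), `|h| <= 1.
  move/cvgrPdist_le : (@cvg_id _ (nbhs (0 : V))) => /(_ _ ltr01).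
  by apply: filterS => h; rewrite sub0r normrN.
apply: (filterS2 _ _ h1 (DKd v 1 ltr01)) => h hn1 hD.
rewrite mul1r in hD.
have bd : {ae @haar R d, forall y, forall i, `|DK v (b1 i) y| <= c i /\ `|DK v (b2 i) y| <= c i}.
  have : \forall y \near almost_everywhere (@haar R d),
      forall i, `|DK v (b1 i) y| <= c i /\ `|DK v (b2 i) y| <= c i.
    apply: filter_forall => i; rewrite /c; case: cid => C /= [H1 H2].
    exact: filterI H1 H2.
  by [].
apply: (filterS3 _ _ KC0 bd (normLinf_ae hD)) => y Ky DKy rest.
have -> : K (v + h) y = K v y + ((K (v + h) y - K v y - DK v h y) + DK v h y).
  by rewrite subrK subrKC.
have coord (u : 'rV[R]_d) i : `|u| <= 1 -> `|u ord0 i| <= 1.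
  apply: le_trans; rewrite [leRHS]/Num.Def.normr/= mx_normrE.
  exact: (le_bigmax _ (fun i : 'I_1 * 'I_d => `|u i.1 i.2|) (ord0, i)).
have [n1 n2] : `|h.1| <= 1 /\ `|h.2| <= 1.
  by move: hn1; rewrite prod_normE ge_max => /andP[].
rewrite (le_trans (ler_normD _ _))// lerD// (le_trans (ler_normD _ _))// lerD//.
  exact: le_trans hn1.
rewrite {1}(bE h) -[X in DK v (X + _)]scale1r DKlin mul1r !DKsum.
rewrite (le_trans (ler_normD _ _))// lerD// (le_trans (ler_norm_sum _ _ _))//;
  apply: ler_sum => i _; rewrite normrM -[leRHS]mul1r ler_pM//.
- exact: coord.
- by case: (DKy i).
- exact: coord.
- by case: (DKy i).
Qed.

(** Local essential bounds, made uniform over the cube by compactness.  The null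
    set may depend on xi. *)
Lemma C1_Linf_cube (p : 'rV[R]_d -> 'rV[R]_d) : continuous p ->
  exists2 C : R, 0 <= C &
  forall xi, cube xi -> {ae @haar R d, forall y, `|K (xi, p xi) y| <= C}.
Proof.
move=> cp.
have /compact_near_coveringP cK := @compact_cube R d.
have : \forall C \near pinfty_nbhs R, forall x, cube x ->
    {ae @haar R d, forall y, `|K (x, p x) y| <= C}.
  apply: (cK R (pinfty_nbhs R) (fun C x => {ae @haar R d, forall y, `|K (x, p x) y| <= C})) => x0 _.
  have [C nC] := C1_Linf_near (x0, p x0).
  have cg : continuous (fun x => (x, p x) : V).
    by apply: continuous_pair => // ?; exact: cvg_id.
  have H1 : \forall x \near x0, {ae @haar R d, forall y, `|K (x, p x) y| <= C}.
    exact: (cg x0 _ nC).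
  have H2 : filter_prod (nbhs x0) (pinfty_nbhs R)
      (fun z => {ae @haar R d, forall y, `|K (z.1, p z.1) y| <= C}).
    exact: (@cvg_fst _ _ (nbhs x0) (pinfty_nbhs R) _ _ H1).
  have H3 : filter_prod (nbhs x0) (pinfty_nbhs R) (fun z => C <= z.2).
    exact: (@cvg_snd _ _ (nbhs x0) (pinfty_nbhs R) _ _ (nbhs_pinfty_ge (num_real C))).
  apply: (filterS2 _ _ H2 H3) => -[x C'] /= H2z H3z.
  by apply: filterS H2z => y Ky; exact: le_trans H3z.
move=> H; have [C [HC C0]] := filter_ex (filterI H (nbhs_pinfty_ge (num_real (0 : R)))).
by exists C.
Qed.

End locally_bounded.

(** * The nonlocal term *)

Section nonlocal_term.
Context {R : realType} {d n : nat}.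
Variable D : mfc_data R d n.
Hypothesis hH : H_assumptions D.
Let U := (ctorus R d * 'rV[R]_d * 'rV[R]_d)%type.
Let F : U -> R := fun z => HL D z.1.1 z.1.2 z.2.
Hypothesis dF : forall z, differentiable F z.
Implicit Types (m mu : ctorus R d).

Lemma ctorus_Lfun1 m : (m : 'rV[R]_d -> R) \in Lfun (@haar R d) 1.
Proof. by apply: continuous_Lfun1; exact: ctorus_continuous. Qed.

(** Both sides are the derivative at s = 0 of s |-> H[m + s mu](x, q): the left one
    for the sup norm on C(T^d), the right one for the L^1 norm. *)
Lemma HL_diff_density m x q mu :
  'd F (m, x, q) (dens_dir mu) = \int[haar]_y (dH D m x q y * mu y).
Proof.
have [_ _ /(_ m (ctorus_Lfun1 m))[fr _ _ _] _] := hH.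
have [d1 E1] := frechet_L1_is_derive mu (fr x q).
have dF0 : differentiable F ((m, x, q) + (0 : R) *: dens_dir mu) by exact: dF.
have [d2 E2] := is_derive_segment dF0.
rewrite scale0r addr0 in E2; rewrite -E2 -E1.
have -> // : (fun r : R => F ((m, x, q) + r *: dens_dir mu)) =
  (fun s : R => HL D (m \+ (fun y => s * mu y)) x q).
apply/funext => s; rewrite /F /= !scaler0 !addr0.
by congr (HL D _ x q); apply/funext => y.
Qed.

(** By Tonelli it is enough to bound, for almost every xi, the integral in y; the
    exceptional null set in y may depend on xi. *)
Lemma product_bounded_integrable (f : 'rV[R]_d * 'rV[R]_d -> R) (C : R) :
  measurable_fun setT f -> 0 <= C ->
  (forall xi, cube xi -> {ae @haar R d, forall y, `|f (xi, y)| <= C}) ->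
  (@haar R d \x @haar R d)%E.-integrable setT (EFin \o f).
Proof.
move=> mf C0 fC.
have mEf : measurable_fun setT (EFin \o f) by exact/measurable_EFinP.
apply/integrable12ltyP => //.
apply: (@le_lt_trans _ _ (\int[@haar R d]_x (cst C%:E x))%E).
  apply: ae_ge0_le_integral => //.
  - by move=> x _; apply: integral_ge0.
  - apply: (measurable_fun_fubini_tonelli_F (abse \o (EFin \o f))) => //=.
    exact: measurableT_comp.
  - apply: filterS (@ae_cube R d) => xi Kxi _.
    apply: ae_bounded_integral => //; last exact: fC.
    by apply: measurableT_comp => //; exact: pair1_measurable.
rewrite integral_cst// [X in (_ * X)%E](_ : _ = 1%E) ?mule1 ?ltry//.
exact: probability_setT.
Qed.

(** Fubini exchanges the integration in x, where the nonlocal term is tested against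
    mu, with that in xi, where its kernel is the density of the derivative of H. *)
Lemma nonlocal_pairing m mu (p : 'rV[R]_d -> 'rV[R]_d) : continuous p ->
  \int[haar]_x ((\int[haar]_xi (dH D m xi (p xi) x * m xi)) * mu x) =
  \int[haar]_xi (m xi * 'd F (m, xi, p xi) (dens_dir mu)).
Proof.
move=> cp.
have [_ _ /(_ m (ctorus_Lfun1 m))[fr CK _ mdH] _] := hH.
have [C C0 bC] := C1_Linf_cube CK cp.
pose k (z : 'rV[R]_d * 'rV[R]_d) : R := dH D m z.1 (p z.1) z.2 * m z.1.
have mp : measurable_fun setT p.
  apply: measurable_fun_rV => i; apply: continuous_measurable_rV => x.
  apply: (@continuous_comp _ _ _ p (fun y : 'rV[R]_d => y ord0 i)); first exact: cp.
  exact: coord_continuous.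
have mk : measurable_fun setT k.
  apply: measurable_funM; last first.
    by apply: measurableT_comp; [exact: measurable_ctorus|exact: measurable_fst].
  have mg : measurable_fun setT
      (fun z : 'rV[R]_d * 'rV[R]_d => (z.1, p z.1, z.2)).
    apply: measurable_fun_pair; last exact: measurable_snd.
    apply: measurable_fun_pair; first exact: measurable_fst.
    by apply: measurableT_comp => //; exact: measurable_fst.
  exact: (measurableT_comp mdH mg).
pose f (z : 'rV[R]_d * 'rV[R]_d) : R := k z * mu z.2.
have mf : measurable_fun setT f.
  apply: measurable_funM => //.
  by apply: measurableT_comp; [exact: measurable_ctorus|exact: measurable_snd].
have bk xi : cube xi -> {ae @haar R d, forall y, `|k (xi, y)| <= C * `|m|}.
  move=> Kxi; apply: filterS (bC xi Kxi) => y Ky.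
  by rewrite normrM ler_pM//; exact: ctorus_norm_ub.
have ik : (@haar R d \x @haar R d)%E.-integrable setT (EFin \o k).
  by apply: product_bounded_integrable bk => //; rewrite mulr_ge0.
have intf : (@haar R d \x @haar R d)%E.-integrable setT (EFin \o f).
  apply: (@product_bounded_integrable _ (C * `|m| * `|mu|)) => //.
    by rewrite !mulr_ge0.
  by move=> xi /bk bxi; exact: ctorus_ae_bounded_mul.
have Fub := Fubini intf.
rewrite /Rintegral; congr fine; symmetry.
transitivity (\int[haar]_xi \int[haar]_y (f (xi, y))%:E)%E.
  apply: eq_integral => xi _; rewrite HL_diff_density -RintegralZl//; last first.
    by apply: Linf_mul_integrable; have [] := fr xi (p xi).
  rewrite /Rintegral fineK; last first.
    apply: integrable_fin_num => //.
    have := Linf_mul_integrable mu (proj1 (fr xi (p xi))).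
    move=> /(integrableZl measurableT (m xi)); exact: eq_integrable.
  by apply: eq_integral => y _; congr EFin; rewrite /f /k /=; ring.
(* for almost every x the kernel is integrable in xi, and mu x comes out *)
rewrite [LHS]Fub; apply: ae_eq_integral => //.
- exact: (measurable_fubini_G intf).
- apply/measurable_EFinP; apply: measurable_funM; last exact: measurable_ctorus.
  have := measurable_fubini_G ik.
  by move=> mG; exact: (measurableT_comp (fine_measurable measurableT) mG).
apply: filterS (ae_integrable2 ik) => y iy _.
rewrite mulrC -RintegralZl// /Rintegral fineK; last first.
  apply: integrable_fin_num => //.
  by have := integrableZl measurableT (mu y) iy.
by apply: eq_integral => xi _; congr EFin; rewrite /f /k mulrC.
Qed.

End nonlocal_term.

(** * The energy inequality *)

(** A probability density is nonnegative almost everywhere, and so are the gaps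
    weighted by it. *)
Lemma haar_ae_ge0 (R : realType) d (K : 'rV[R]_d -> R) : continuous K ->
  {ae @haar R d, forall x, 0 <= K x} ->
  0 <= \int[haar]_x K x /\
  (\int[haar]_x K x = 0 -> {ae @haar R d, forall x, K x = 0}).
Proof.
move=> cK K0.
have mK : measurable_fun setT (EFin \o K).
  by apply/measurable_EFinP; exact: continuous_measurable_rV.
have E : \int[haar]_x K x = fine (\int[haar]_x `|(K x)%:E|).
  congr fine; apply: ae_eq_integral => //; first exact: measurableT_comp.
  by move: K0; apply: filterS => x Kx _; rewrite /= ger0_norm.
split; first by rewrite E; apply: fine_ge0; exact: integral_ge0.
rewrite E => /eqP; rewrite fine_eq0; last first.
  by apply: integrable_fin_num => //; apply: integrable_abse; exact: continuous_haar_integrable.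
move=> /eqP /(ae_eq_integral_abs _ measurableT mK); apply: filterS => x /(_ I).
by case.
Qed.

(** k1 and k2 are the gaps of the two concave tangent inequalities, and the last two
    hypotheses are the convex ones; a_i and b_i are the values of calH[., p1] and
    calH[., p2] at m_i, which all cancel in the sum. *)
Lemma energy_arith (R : realFieldType) (k1 k2 a1 a2 b1 b2 w1 w2 d1 d2 e n1 : R) :
  k1 = a1 - b1 + w1 -> k2 = b2 - a2 + w2 -> e = - (w1 + w2) -> n1 = - d1 ->
  0 <= k1 -> 0 <= k2 -> a1 + n1 <= a2 -> b2 + d2 <= b1 ->
  e - (d1 - d2) <= 0 /\ (e - (d1 - d2) = 0 -> k1 = 0 /\ a1 + n1 = a2).
Proof. by move=> *; split=> [|*]; [lra|split; lra]. Qed.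

Section energy.
Context {R : realType} {d n : nat}.
Variable D : mfc_data R d n.
Let U := (ctorus R d * 'rV[R]_d * 'rV[R]_d)%type.
Let F : U -> R := fun z => HL D z.1.1 z.1.2 z.2.
Hypothesis hC2 : C2 F.
Hypothesis hconvex : forall (m : ctorus R d) (p : 'rV[R]_d -> 'rV[R]_d),
  prob_density m -> continuous p -> Zperiodic p ->
  forall mu : ctorus R d, mu != 0 -> 0 < D2 (calH D p) m mu mu.
Hypothesis hconcave : forall m : ctorus R d, prob_density m ->
  forall x, strictly_concave (HL D m x).
Implicit Types (m mu : ctorus R d) (p q : 'rV[R]_d -> 'rV[R]_d).

Let C1F : C1 F. Proof. exact: C2_C1. Qed.

Lemma prob_density_segment m1 m2 (s : R) : prob_density m1 -> prob_density m2 ->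
  0 <= s <= 1 -> prob_density (m1 + s *: (m2 - m1)).
Proof.
move=> [_ m1_ge0 m1_1] [_ m2_ge0 m2_1] /andP[s0 s1].
split; first exact: ctorus_Lfun1.
  apply: filterS2 m1_ge0 m2_ge0 => x a0 b0.
  have -> : (m1 + s *: (m2 - m1)) x = (1 - s) * m1 x + s * m2 x.
    by rewrite [LHS](_ : _ = m1 x + s * (m2 x - m1 x))//; ring.
  by rewrite addr_ge0// mulr_ge0// subr_ge0.
rewrite (_ : \int[haar]_x _ = \int[haar]_x ((1 - s) * m1 x + s * m2 x)); last first.
  apply: eq_Rintegral => x _.
  by rewrite [LHS](_ : _ = m1 x + s * (m2 x - m1 x))//; ring.
have I m := continuous_haar_integrable (@ctorus_continuous R d m).
have cs (a : R) m : continuous (fun x => a * m x).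
  by apply: continuous_mulf; [exact: cst_continuous|exact: ctorus_continuous].
rewrite RintegralD//; [|exact: continuous_haar_integrable..].
by rewrite !RintegralZl// m1_1 m2_1; ring.
Qed.

(** The segment from m1 to m2 consists of probability densities, so the second
    differential is positive along all of it. *)
Lemma calH_strict_tangent m1 m2 p : prob_density m1 -> prob_density m2 ->
  continuous p -> Zperiodic p -> m1 != m2 ->
  averaged F p m1 + averaged_diff F p m1 (m2 - m1) < averaged F p m2.
Proof.
move=> pm1 pm2 cp pp m12.
have dA m := averaged_differentiable C1F cp m.
have := @D2_gt0_convex _ _ (averaged F p) m1 (m2 - m1) (fun m => (dA m).1).
rewrite subrKC (dA m1).2; apply=> s s01.
apply: hconvex => //; first exact: prob_density_segment.
by rewrite subr_eq0 eq_sym.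
Qed.

(** The gap in the tangent inequality for the concave function H[m](x, .) at p(x),
    weighted by the density. *)
Definition momentum_gap m p q x := m x * (HL D m x (p x) +
  dot (dHdp D m x (p x)) (q x - p x) - HL D m x (q x)).

Lemma momentum_gapP m p q x : prob_density m -> 0 <= m x ->
  0 <= momentum_gap m p q x /\
  (momentum_gap m p q x = 0 -> m x = 0 \/ p x = q x).
Proof.
move=> pm mx0.
have [pq|pq] := eqVneq (q x) (p x).
  rewrite /momentum_gap pq subrr (_ : dot _ _ = 0); last first.
    by rewrite /dot big1// => i _; rewrite !mxE mulr0.
  by rewrite addr0 subrr mulr0; split=> // _; right.
have v0 : q x - p x != 0 by rewrite subr_eq0.
have gap : 0 < HL D m x (p x) + dot (dHdp D m x (p x)) (q x - p x) - HL D m x (q x).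
  have dFp : is_derive (0 : R) (1 : R) (fun s : R => HL D m x (p x + s *: (q x - p x)))
      (dot (dHdp D m x (p x)) (q x - p x)).
    exact: (is_derive_momentum_line hC2).
  have := strictly_concave_tangent (hconcave pm x) dFp v0.
  by rewrite subrKC subr_gt0.
split; first by rewrite mulr_ge0// ltW.
move=> /eqP; rewrite mulf_eq0 (gt_eqF gap) orbF => /eqP ->; by left.
Qed.

Lemma continuous_dotf p q : continuous p -> continuous q ->
  continuous (fun x => dot (p x) (q x)).
Proof.
move=> cp cq; apply: continuous_sumf => i; apply: continuous_mulf => x.
  apply: (@continuous_comp _ _ _ p (fun y : 'rV[R]_d => y ord0 i)); first exact: cp.
  exact: coord_continuous.
apply: (@continuous_comp _ _ _ q (fun y : 'rV[R]_d => y ord0 i)); first exact: cq.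
exact: coord_continuous.
Qed.

Lemma continuous_dHdp m p : continuous p -> continuous (fun x => dHdp D m x (p x)).
Proof.
move=> cp; apply: continuous_rV => i; rewrite /dHdp /grad.
under eq_fun do rewrite mxE.
exact: (continuous_velocity hC2).
Qed.

Lemma continuous_subv p q : continuous p -> continuous q ->
  continuous (fun x => p x - q x).
Proof. by move=> cp cq x; exact: (cvgB (cp x) (cq x)). Qed.

Lemma haar_momentum_gap m p q : continuous p -> continuous q ->
  continuous (momentum_gap m p q) /\
  \int[haar]_x momentum_gap m p q x = averaged F p m - averaged F q m +
    \int[haar]_x (m x * dot (dHdp D m x (p x)) (q x - p x)).
Proof.
move=> cp cq.
have cm := @ctorus_continuous R d m.
have c1 := continuous_mulf cm (continuous_along_graph C1F cp (m := m)).
have c2 := continuous_mulf cm (continuous_along_graph C1F cq (m := m)).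
have c3 : continuous (fun x => m x * dot (dHdp D m x (p x)) (q x - p x)).
  apply: continuous_mulf => //; apply: continuous_dotf; first exact: continuous_dHdp.
  exact: continuous_subv.
have E : momentum_gap m p q = fun x =>
    m x * F (m, x, p x) - m x * F (m, x, q x) + m x * dot (dHdp D m x (p x)) (q x - p x).
  by apply/funext => x; rewrite /momentum_gap /F /=; ring.
have c12 := continuous_subf c1 c2.
rewrite E; split; first exact: (continuous_addf c12 c3).
rewrite RintegralD//; last 2 first.
- by apply: continuous_haar_integrable; exact: continuous_subf.
- exact: continuous_haar_integrable.
by rewrite RintegralB//; exact: continuous_haar_integrable.
Qed.

(** The sum of the four tangent inequalities, two convex in m and two concave in p. *)
Lemma energy_le0 m1 m2 p1 p2 : prob_density m1 -> prob_density m2 ->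
  continuous p1 -> continuous p2 -> Zperiodic p1 -> Zperiodic p2 ->
  let E := \int[haar]_x dot (p1 x - p2 x)
      (m1 x *: dHdp D m1 x (p1 x) - m2 x *: dHdp D m2 x (p2 x)) -
    (averaged_diff F p1 m1 (m1 - m2) - averaged_diff F p2 m2 (m1 - m2)) in
  E <= 0 /\ (E = 0 -> m1 = m2 /\
    {ae @haar R d, forall x, m1 x = 0 \/ p1 x = p2 x}).
Proof.
move=> pm1 pm2 cp1 cp2 pp1 pp2 E.
have [cK1 K1E] := haar_momentum_gap m1 cp1 cp2.
have [cK2 K2E] := haar_momentum_gap m2 cp2 cp1.
have ae1 : {ae @haar R d, forall x, 0 <= momentum_gap m1 p1 p2 x}.
  by case: (pm1) => _ + _; apply: filterS => x mx; exact: (momentum_gapP _ _ _ _).1.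
have ae2 : {ae @haar R d, forall x, 0 <= momentum_gap m2 p2 p1 x}.
  by case: (pm2) => _ + _; apply: filterS => x mx; exact: (momentum_gapP _ _ _ _).1.
have [K1_ge0 K1_0] := haar_ae_ge0 cK1 ae1.
have [K2_ge0 _] := haar_ae_ge0 cK2 ae2.
have T m m' p : prob_density m -> prob_density m' -> continuous p -> Zperiodic p ->
    averaged F p m + averaged_diff F p m (m' - m) <= averaged F p m' /\
    (averaged F p m + averaged_diff F p m (m' - m) = averaged F p m' -> m = m').
  move=> pm pm' cp pp; have [->|mm'] := eqVneq m m'.
    have [_ dA] := averaged_differentiable C1F cp m'.
    by rewrite subrr -dA linear0 addr0.
  have lt := calH_strict_tangent pm pm' cp pp mm'.
  by split; [exact: ltW|move=> e; rewrite e ltxx in lt].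
have [T1 T10] := T m1 m2 p1 pm1 pm2 cp1 pp1.
have [T2 _] := T m2 m1 p2 pm2 pm1 cp2 pp2.
have N1 : averaged_diff F p1 m1 (m2 - m1) = - averaged_diff F p1 m1 (m1 - m2).
  have [_ <-] := averaged_differentiable C1F cp1 m1.
  by rewrite -linearN opprB.
have cV m p : continuous p -> continuous (fun x => dHdp D m x (p x)).
  by move=> cp; exact: continuous_dHdp.
have cW m p q : continuous p -> continuous q ->
    continuous (fun x => m x * dot (dHdp D m x (p x)) (q x - p x)).
  move=> cp cq; apply: continuous_mulf; first exact: ctorus_continuous.
  by apply: continuous_dotf; [exact: cV|exact: continuous_subv].
have EE : \int[haar]_x dot (p1 x - p2 x)
      (m1 x *: dHdp D m1 x (p1 x) - m2 x *: dHdp D m2 x (p2 x)) =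
    - (\int[haar]_x (m1 x * dot (dHdp D m1 x (p1 x)) (p2 x - p1 x)) +
       \int[haar]_x (m2 x * dot (dHdp D m2 x (p2 x)) (p1 x - p2 x))).
  rewrite -RintegralD//; last 2 first.
  - by apply: continuous_haar_integrable; exact: cW.
  - by apply: continuous_haar_integrable; exact: cW.
  rewrite -mulN1r -RintegralZl//; last first.
    by apply: continuous_haar_integrable; apply: continuous_addf; exact: cW.
  apply: eq_Rintegral => x _; rewrite mulN1r /dot !mulr_sumr -big_split/= -sumrN.
  by apply: eq_bigr => i _; rewrite !mxE; ring.
have [E_le0 E_eq0] := energy_arith K1E K2E EE N1 K1_ge0 K2_ge0 T1 T2.
split=> // E0; have [K0 A0] := E_eq0 E0; split; first exact: T10.
case: (pm1) => _ + _; move: (K1_0 K0); apply: filterS2 => x Kx mx.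
exact: (momentum_gapP _ _ _ mx).2.
Qed.

End energy.

(** * The parabolic maximum principle *)

Section maximum_principle.
Context {R : realType} {d : nat}.

(** If the second derivative k were positive, dg would be positive just to the right
    of 0, and g would exceed its maximum by the mean value theorem. *)
Lemma second_derivative_at_max (g dg : R -> R) (k : R) :
  (forall s, is_derive s (1 : R) g (dg s)) -> is_derive (0 : R) (1 : R) dg k ->
  (forall s, g s <= g 0) -> dg 0 = 0 /\ k <= 0.
Proof.
move=> gd dgd gmax.
have g0 : dg 0 = 0.
  have itv0 : (0 : R) \in `](-1), 1[ by rewrite in_itv/= ltrN10 ltr01.
  have h11 : (-1 : R) <= 1 by lra.
  have dg_ s : s \in `]-1, (1 : R)[%R -> derivable g s 1 by move=> _; case: (gd s).
  have [_ E] := derive1_at_max h11 dg_ itv0 (fun s _ => gmax s).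
  by have [_ <-] := gd 0.
split=> //; rewrite leNgt; apply/negP => k0.
have [r r0 rP] := is_derive_expansion dgd (divr_gt0 k0 (ltr0n R 2)).
pose s := r / 2.
have s0 : 0 < s by rewrite divr_gt0.
have cg : {within `[0, s], continuous g}.
  by apply: derivable_within_continuous => x _; case: (gd x).
have [c] := MVT s0 (fun x _ => gd x) cg.
rewrite in_itv/= subr0 => /andP[c0 cs] E.
have : dg c * s <= 0 by rewrite -E subr_le0.
rewrite pmulr_lle0// leNgt => /negP; apply.
have := rP c; rewrite c0 (lt_trans cs) ?ltr_pdivrMr ?ltr_pMr ?ltr1n// => /(_ isT).
rewrite add0r g0 subr0 ler_norml => /andP[lo _].
have : 0 < k / 2 * c by rewrite mulr_gt0 ?divr_gt0.
by move: lo; lra.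
Qed.

Lemma torus_C2_max (f : 'rV[R]_d -> R) x : torus_C2 f -> (forall y, f y <= f x) ->
  grad f x = 0 /\ laplacian f x <= 0.
Proof.
move=> [[_ _ df] C2f] fmax.
have P i : partial i f x = 0 /\ partial i (partial i f) x <= 0.
  have [_ _ d2f] := C2f i.
  have gd s := is_derive_line (z := s) (x := x) ((df i).1 _).
  have := is_derive_line (z := 0) (x := x) ((d2f i).1 _).
  rewrite scale0r add0r => dgd.
  have [|g0 k0] := second_derivative_at_max gd dgd.
    by move=> s; rewrite scale0r add0r.
  by rewrite scale0r add0r in g0.
split; first by apply/rowP => i; rewrite !mxE (P i).1.
by rewrite /laplacian -oppr_ge0 -sumrN sumr_ge0// => i _; rewrite oppr_ge0 (P i).2.
Qed.

(** The time variable runs backwards: the data are given at t = T.  If w were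
    positive somewhere, w + eta (t - T) with a small eta > 0 would have a positive
    maximum over [t0, T] times the torus.  It is not attained at t = T; at an
    earlier time the gradient vanishes, the Laplacian is at most zero and w_t is
    at most - eta, which contradicts the inequality at critical points. *)
Lemma parabolic_maximum (T nu : R) (w wt : R -> 'rV[R]_d -> R) : 0 < T -> 0 < nu ->
  {within `[0, T]%classic `*` [set: 'rV[R]_d], continuous (fun z => w z.1 z.2)} ->
  (forall t, 0 <= t <= T -> torus_C2 (w t)) ->
  (forall t x, 0 < t < T -> is_derive t (1 : R) (w ^~ x) (wt t x)) ->
  (forall x, w T x = 0) ->
  (forall t x, 0 < t < T -> grad (w t) x = 0 -> 0 <= wt t x + nu * laplacian (w t) x) ->
  forall t x, 0 < t < T -> w t x <= 0.
Proof.
move=> T0 nu0 cw C2w dw wT crit t0 x0 /andP[t00 t0T].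
have pw t : 0 <= t <= T -> Zperiodic (w t) by move=> /C2w[[]].
rewrite leNgt; apply/negP => w0.
(* half of w t0 x0 survives the penalization: eta (T - t0) < w t0 x0 / 2 *)
pose eta := w t0 x0 / (2 * T).
have eta0 : 0 < eta by rewrite divr_gt0// mulr_gt0.
pose phi (z : R * 'rV[R]_d) := w z.1 z.2 + eta * (z.1 - T).
pose K := `[t0, T]%classic `*` @cube R d.
have tK t : t0 <= t <= T -> 0 <= t <= T.
  by move=> /andP[a ->]; rewrite andbT (le_trans _ a)// ltW.
have [y0 Ky0 y0E] : exists2 y, cube y & w t0 y = w t0 x0.
  by apply: periodic_cube; apply: pw; rewrite !ltW.
have K0 : K !=set0 by exists (t0, y0); split=> //=; rewrite in_itv/= lexx ltW.
have cK : compact K.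
  by apply: compact_setX; [exact: segment_compact|exact: compact_cube].
have cphi : {within K, continuous phi}.
  apply: (@continuous_addf _ (subspace K) (fun z => w z.1 z.2) (fun z => eta * (z.1 - T))).
    apply: continuous_subspaceW cw => -[t x] /= [tt _]; split=> //=.
    by move: tt; rewrite /= !in_itv/=; exact: tK.
  apply: continuous_subspaceT.
  apply: continuous_mulf; first exact: cst_continuous.
  apply: continuous_subf; last exact: cst_continuous.
  by move=> z; exact: cvg_fst.
have [[t x] /set_mem[/= tI Kx] max] := compact_EVT_max K0 cK cphi.
move: tI; rewrite in_itv/= => tI; have /andP[tl tr] := tI.
(* by periodicity the maximum over the cube is a maximum over R^d *)
have max' s y : t0 <= s <= T -> phi (s, y) <= phi (t, x).
  move=> sI; have [z Kz zE] := periodic_cube y (pw s (tK s sI)).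
  have -> : phi (s, y) = phi (s, z) by rewrite /phi /= zE.
  by apply: max; apply/mem_set; split => //=; rewrite in_itv.
have phi0 : 0 < phi (t, x).
  apply: (@lt_le_trans _ _ (phi (t0, x0))); last by apply: max'; rewrite lexx ltW.
  rewrite /phi /=.
  have -> : w t0 x0 = eta * (2 * T) by rewrite /eta divfK// gt_eqF// mulr_gt0.
  by rewrite -mulrDr mulr_gt0//; lra.
have tT : t < T.
  rewrite lt_neqAle tr andbT; apply/eqP => tE.
  by move: phi0; rewrite /phi /= tE wT subrr mulr0 add0r ltxx.
have t_in : 0 < t < T by rewrite tT andbT (lt_le_trans t00).
have [g0 l0] : grad (w t) x = 0 /\ laplacian (w t) x <= 0.
  apply: torus_C2_max; first exact: C2w (tK _ tI).
  by move=> y; have := max' t y tI; rewrite /phi /= lerD2r.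
have wtle : wt t x <= - eta.
  have dN : is_derive t (1 : R) (fun s => - w s x) (- wt t x).
    by have [d1 <-] := dw t x t_in; split; [exact: derivableN|exact: deriveN].
  have Tt : 0 < T - t by rewrite subr_gt0.
  rewrite -lerN2 opprK; apply: (is_derive_right_ge dN Tt) => h /andP[h0 hT].
  have := max' (t + h) x; rewrite /phi /=.
  have -> : t0 <= t + h <= T by apply/andP; split; lra.
  by move=> /(_ isT); lra.
have := crit t x t_in g0.
have : nu * laplacian (w t) x <= 0 by rewrite pmulr_rle0.
by move: wtle eta0; lra.
Qed.

End maximum_principle.

(** * The energy identity at a fixed time *)

Section haar_linear.
Context {R : realType} {d : nat}.
Implicit Types f g : 'rV[R]_d -> R.

Lemma haarD f g : continuous f -> continuous g ->
  \int[haar]_x (f x + g x) = \int[haar]_x f x + \int[haar]_x g x.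
Proof. by move=> cf cg; apply: RintegralD => //; exact: continuous_haar_integrable. Qed.

Lemma haarB f g : continuous f -> continuous g ->
  \int[haar]_x (f x - g x) = \int[haar]_x f x - \int[haar]_x g x.
Proof. by move=> cf cg; apply: RintegralB => //; exact: continuous_haar_integrable. Qed.

Lemma haarZ (a : R) f : continuous f -> \int[haar]_x (a * f x) = a * \int[haar]_x f x.
Proof. by move=> cf; apply: RintegralZl => //; exact: continuous_haar_integrable. Qed.

(** Brings the identities proved on (0, T) to the end points. *)
Lemma continuous_zero_itv (T : R) (f : R -> R) : 0 < T -> continuous f ->
  (forall s, 0 < s < T -> f s = 0) -> forall t, 0 <= t <= T -> f t = 0.
Proof.
move=> T0 cf f0 t /andP[t0 tT]; apply/eqP; rewrite -normr_eq0 eq_le normr_ge0 andbT.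
rewrite leNgt; apply/negP => ft.
move/cvgrPdist_lt : (cf t) => /(_ _ ft) /nbhs_ballP[r /= r0 rP].
pose th := Num.min (1 / 2) (r / (2 * T)).
have th0 : 0 < th by rewrite lt_min !divr_gt0// mulr_gt0.
have th1 : th < 1 by rewrite gt_min ltr_pdivrMr// mul1r ltr1n.
have thr : th * T < r.
  rewrite -ltr_pdivlMr// gt_min [X in _ || X](_ : _ = true) ?orbT//.
  by rewrite invfM mulrA ltr_pM2r ?invr_gt0// ltr_pdivrMr// ltr_pMr// ltr1n.
(* a point near t, pulled towards the midpoint of [0, T] and so interior to it *)
pose s := t + th * (T / 2 - t).
have sI : 0 < s < T.
  have -> : s = (1 - th) * t + th * (T / 2) by rewrite /s; ring.
  have a1 : 0 <= (1 - th) * t by rewrite mulr_ge0// subr_ge0 ltW.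
  have a2 : (1 - th) * t <= (1 - th) * T by rewrite ler_wpM2l// subr_ge0 ltW.
  have a3 : 0 < th * T by rewrite mulr_gt0.
  by apply/andP; split; lra.
have : `|f t - f s| < `|f t|.
  apply: rP; rewrite /ball/= /s opprD addrA subrr sub0r normrN normrM gtr0_norm//.
  rewrite (le_lt_trans _ thr)// ler_wpM2l ?(ltW th0)// ler_norml.
  by apply/andP; split; lra.
by rewrite (f0 _ sI) subr0 ltxx.
Qed.

Lemma ctorus_of (f : 'rV[R]_d -> R) : continuous f -> Zperiodic f ->
  exists g : ctorus R d, (g : 'rV[R]_d -> R) = f.
Proof.
move=> cf pf; have ft : f \in @torus_continuous R d by rewrite inE.
by exists (CTorus ft).
Qed.

End haar_linear.

(** Pointwise elimination of the time derivatives a_i of u_i and b_i of m_i by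
    means of the equations, in which l, k are Laplacians, h, n the local and
    nonlocal Hamiltonian terms, and v the divergence of the flux. *)
Lemma energy_integrand (R : realFieldType)
    (nu u1 u2 m1 m2 a1 a2 b1 b2 l1 l2 k1 k2 h1 h2 n1 n2 v1 v2 dv lw lm : R) :
  a1 + nu * l1 + h1 + n1 = 0 -> a2 + nu * l2 + h2 + n2 = 0 ->
  b1 - nu * k1 + v1 = 0 -> b2 - nu * k2 + v2 = 0 ->
  dv = v1 - v2 -> lw = l1 - l2 -> lm = k1 - k2 ->
  (u1 - u2) * (b1 - b2) + (a1 - a2) * (m1 - m2) =
  nu * ((u1 - u2) * lm - lw * (m1 - m2)) - (u1 - u2) * dv
  - ((h1 + n1) * (m1 - m2) - (h2 + n2) * (m1 - m2)).
Proof.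
move=> e1 e2 e3 e4 -> -> ->.
have -> : b1 = nu * k1 - v1 by lra.
have -> : b2 = nu * k2 - v2 by lra.
have -> : a1 = - (nu * l1 + h1 + n1) by lra.
have -> : a2 = - (nu * l2 + h2 + n2) by lra.
by ring.
Qed.

Section fixed_time.
Context {R : realType} {d n : nat}.
Variable D : mfc_data R d n.
Hypothesis hH : H_assumptions D.
Let U := (ctorus R d * 'rV[R]_d * 'rV[R]_d)%type.
Let F : U -> R := fun z => HL D z.1.1 z.1.2 z.2.
Hypothesis hC2 : C2 F.
Implicit Types (m mu : ctorus R d) (p : 'rV[R]_d -> 'rV[R]_d).

Let C1F : C1 F. Proof. exact: C2_C1. Qed.

Definition nonlocal m p x := \int[haar]_xi (dH D m xi (p xi) x * m xi).

(** The two zero order terms of the equation for u are together the density of the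
    differential of calH in m. *)
Lemma costate_pairing m mu p : continuous p -> continuous (nonlocal m p) ->
  \int[haar]_x ((HL D m x (p x) + nonlocal m p x) * mu x) = averaged_diff F p m mu.
Proof.
move=> cp cB.
have dF z : differentiable F z by case: hC2.
have cmu := @ctorus_continuous R d mu.
have cm := @ctorus_continuous R d m.
have cH : continuous (fun x => HL D m x (p x)) := continuous_along_graph C1F cp (m := m).
have cd : continuous (fun x => 'd F (m, x, p x) (dens_dir mu)).
  exact: continuous_diff_along_graph.
rewrite /averaged_diff (_ : \int[haar]_x _ =
  \int[haar]_x (HL D m x (p x) * mu x + nonlocal m p x * mu x)); last first.
  by apply: eq_Rintegral => x _; rewrite mulrDl.
rewrite haarD; [|exact: continuous_mulf..].
rewrite haarD; [|exact: continuous_mulf..].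
rewrite (nonlocal_pairing hH dF m mu cp); congr (_ + _).
by apply: eq_Rintegral => x _; rewrite mulrC.
Qed.

Definition flux m p y := m y *: dHdp D m y (p y).

Lemma torus_C1_flux m p i : torus_C1 m -> (forall j, torus_C1 (fun y => p y ord0 j)) ->
  torus_C1 (fun y => flux m p y ord0 i).
Proof.
move=> Cm Cp.
rewrite (_ : (fun y => _) = fun y => m y * partial i (HL D m y) (p y)); last first.
  by apply/funext => y; rewrite /flux !mxE.
apply: torus_C1M => //.
apply: (torus_C1_velocity hC2) => // y k q.
have [_ /(_ m (ctorus_Lfun1 m))[pH _] _ _] := hH.
exact: pH.
Qed.

Lemma divergenceB (V W : 'rV[R]_d -> 'rV[R]_d) x :
  (forall i, torus_C1 (fun y => V y ord0 i)) ->
  (forall i, torus_C1 (fun y => W y ord0 i)) ->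
  divergence (fun y => V y - W y) x = divergence V x - divergence W x.
Proof.
move=> CV CW; rewrite /divergence -sumrB; apply: eq_bigr => i _.
rewrite (_ : (fun y => _) = fun y => V y ord0 i - W y ord0 i); last first.
  by apply/funext => y; rewrite !mxE.
have [_ _ dV] := CV i; have [_ _ dW] := CW i.
exact: (deriveB ((dV i).1 x) ((dW i).1 x)).
Qed.

(** The derivative of the pairing, written with the equations at one time: the
    Laplacian is symmetric, and the divergence is moved onto u1 - u2.  The nonlocal
    terms are continuous because the equations express them by the other terms. *)
Lemma energy_identity (nu : R) (m1 m2 : ctorus R d) (u1 u2 a1 a2 b1 b2 : 'rV[R]_d -> R) :
  torus_C2 u1 -> torus_C2 u2 -> torus_C2 m1 -> torus_C2 m2 ->
  continuous a1 -> continuous a2 ->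
  (forall x, a1 x + nu * laplacian u1 x + HL D m1 x (grad u1 x) +
    nonlocal m1 (grad u1) x = 0) ->
  (forall x, a2 x + nu * laplacian u2 x + HL D m2 x (grad u2 x) +
    nonlocal m2 (grad u2) x = 0) ->
  (forall x, b1 x - nu * laplacian m1 x + divergence (flux m1 (grad u1)) x = 0) ->
  (forall x, b2 x - nu * laplacian m2 x + divergence (flux m2 (grad u2)) x = 0) ->
  \int[haar]_x ((u1 x - u2 x) * (b1 x - b2 x) + (a1 x - a2 x) * (m1 x - m2 x)) =
  \int[haar]_x dot (grad u1 x - grad u2 x) (flux m1 (grad u1) x - flux m2 (grad u2) x)
  - (averaged_diff F (grad u1) m1 (m1 - m2) - averaged_diff F (grad u2) m2 (m1 - m2)).
Proof.
move=> Cu1 Cu2 Cm1 Cm2 ca1 ca2 hj1 hj2 fp1 fp2.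
have Cg (u : 'rV[R]_d -> R) : torus_C2 u -> forall j, torus_C1 (fun y => grad u y ord0 j).
  move=> [_ C2u] j; rewrite (_ : (fun y => _) = partial j u)//.
  by apply/funext => y; rewrite mxE.
have cg (u : 'rV[R]_d -> R) : torus_C2 u -> continuous (grad u).
  by move=> Cu; apply: continuous_rV => j; have [] := Cg u Cu j.
have Hc m (u : 'rV[R]_d -> R) : torus_C2 u -> continuous (fun x => HL D m x (grad u x)).
  by move=> Cu; exact: (continuous_along_graph C1F (cg _ Cu) (m := m)).
(* the equation for u expresses the nonlocal term by continuous ones *)
have cB m (u a : 'rV[R]_d -> R) : torus_C2 u -> continuous a ->
    (forall x, a x + nu * laplacian u x +
    HL D m x (grad u x) + nonlocal m (grad u) x = 0) -> continuous (nonlocal m (grad u)).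
  move=> Cu ca hj.
  have -> : nonlocal m (grad u) = fun x =>
      (-1) * (a x + nu * laplacian u x + HL D m x (grad u x)).
    by apply/funext => x; have := hj x => /eqP; rewrite addrC addr_eq0 mulN1r => /eqP.
  apply: continuous_mulf; first exact: cst_continuous.
  apply: continuous_addf; last exact: Hc.
  apply: continuous_addf => //; apply: continuous_mulf; first exact: cst_continuous.
  exact: continuous_laplacian.
have cB1 := cB _ _ _ Cu1 ca1 hj1; have cB2 := cB _ _ _ Cu2 ca2 hj2.
pose w x := u1 x - u2 x; pose mu := m1 - m2.
have Cw : torus_C2 w by exact: torus_C2B.
have Cmu : torus_C2 mu by exact: (torus_C2B Cm1 Cm2).
have CV1 i := torus_C1_flux i (proj1 Cm1) (Cg _ Cu1).
have CV2 i := torus_C1_flux i (proj1 Cm2) (Cg _ Cu2).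
pose V x := flux m1 (grad u1) x - flux m2 (grad u2) x.
have CV i : torus_C1 (fun y => V y ord0 i).
  rewrite (_ : (fun y => _) = fun y => flux m1 (grad u1) y ord0 i - flux m2 (grad u2) y ord0 i).
    exact (torus_C1B (CV1 i) (CV2 i)).
  have rVB (a b : 'rV[R]_d) : (a - b) ord0 i = a ord0 i - b ord0 i by rewrite !mxE.
  by apply/funext => y; exact: rVB.
have -> : \int[haar]_x ((u1 x - u2 x) * (b1 x - b2 x) + (a1 x - a2 x) * (m1 x - m2 x)) =
  \int[haar]_x (nu * (w x * laplacian mu x - laplacian w x * mu x) - w x * divergence V x
    - ((HL D m1 x (grad u1 x) + nonlocal m1 (grad u1) x) * mu x -
       (HL D m2 x (grad u2 x) + nonlocal m2 (grad u2) x) * mu x)).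
  apply: eq_Rintegral => x _.
  have dV : divergence V x = _ := divergenceB x CV1 CV2.
  have lw : laplacian w x = _ := laplacianB x Cu1 Cu2.
  have lmu : laplacian mu x = _ := laplacianB x Cm1 Cm2.
  exact (energy_integrand (u1 x) (u2 x) (m1 x) (m2 x) (hj1 x) (hj2 x) (fp1 x) (fp2 x)
    dV lw lmu).
have cw : continuous w by case: Cw => -[].
have cmu : continuous mu by exact: ctorus_continuous.
have c1 : continuous (fun x => w x * laplacian mu x).
  by apply: continuous_mulf => //; exact: continuous_laplacian.
have c2 : continuous (fun x => laplacian w x * mu x).
  by apply: continuous_mulf => //; exact: continuous_laplacian.
have c12 := continuous_subf c1 c2.
have c12' : continuous (fun x => nu * (w x * laplacian mu x - laplacian w x * mu x)).
  by apply: continuous_mulf => //; exact: cst_continuous.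
have c3 : continuous (fun x => w x * divergence V x).
  apply: continuous_mulf => //; apply: continuous_sumf => i.
  by have [_ _ dV] := CV i; exact: (dV i).2.
have c4 : continuous (fun x => (HL D m1 x (grad u1 x) + nonlocal m1 (grad u1) x) * mu x).
  by apply: continuous_mulf => //; apply: continuous_addf => //; exact: Hc.
have c5 : continuous (fun x => (HL D m2 x (grad u2 x) + nonlocal m2 (grad u2) x) * mu x).
  by apply: continuous_mulf => //; apply: continuous_addf => //; exact: Hc.
rewrite (haarB (continuous_subf c12' c3) (continuous_subf c4 c5)).
rewrite (haarB c12' c3) (haarB c4 c5) (haarZ _ c12) (haarB c1 c2).
rewrite (haar_laplacian_sym Cw Cmu) subrr mulr0 sub0r (haar_divergence (proj1 Cw) CV) opprK.
rewrite (costate_pairing mu (cg _ Cu1) cB1) (costate_pairing mu (cg _ Cu2) cB2).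
congr (_ - _); apply: eq_Rintegral => x _.
by rewrite (gradB x (proj1 Cu1) (proj1 Cu2)).
Qed.

End fixed_time.

(** * Comparison of two solutions *)

Section solutions.
Context {R : realType} {d n : nat}.
Variables (D : mfc_data R d n) (T nu : R) (uT m0 : 'rV[R]_d -> R).
Hypothesis hH : H_assumptions D.
Hypothesis T0 : 0 < T.
Hypothesis nu0 : 0 < nu.
Hypothesis hC2 : C2 (fun z : ctorus R d * 'rV[R]_d * 'rV[R]_d =>
  HL D z.1.1 z.1.2 z.2).
Hypothesis hconvex : forall (m : ctorus R d) (p : 'rV[R]_d -> 'rV[R]_d),
  prob_density m -> continuous p -> Zperiodic p ->
  forall mu : ctorus R d, mu != 0 -> 0 < D2 (calH D p) m mu mu.
Hypothesis hconcave : forall m : ctorus R d, prob_density m ->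
  forall x, strictly_concave (HL D m x).

Lemma solution_slice u m t : classical_solution D T nu uT m0 u m ->
  0 <= t <= T -> [/\ torus_C2 (u t), torus_C2 (m t) & prob_density (m t)].
Proof.
move=> [per [Cu Cm] dens _ _ _ _] tI; have [pu pm] := per t tI.
by split; [exact: C12_torus_C2 Cu tI pu|exact: C12_torus_C2 Cm tI pm|exact: dens].
Qed.

Lemma torus_C2_grad (u : 'rV[R]_d -> R) : torus_C2 u ->
  continuous (grad u) /\ Zperiodic (grad u).
Proof.
move=> [[pu _ _] C2u]; split.
  apply: continuous_rV => j; rewrite /grad; under eq_fun do rewrite mxE.
  by have [] := C2u j.
by move=> x k; apply/rowP => j; rewrite !mxE; have [pj _ _] := C2u j; exact: pj.
Qed.

Lemma duality_derivative u1 m1 u2 m2 (M1 M2 : ctorus R d) t :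
  classical_solution D T nu uT m0 u1 m1 ->
  classical_solution D T nu uT m0 u2 m2 -> 0 < t < T ->
  (M1 : 'rV[R]_d -> R) = m1 t -> (M2 : 'rV[R]_d -> R) = m2 t ->
  is_derive t (1 : R) (fun s => \int[haar]_x ((u1 s x - u2 s x) * (m1 s x - m2 s x)))
  (\int[haar]_x dot (grad (u1 t) x - grad (u2 t) x)
     (M1 x *: dHdp D M1 x (grad (u1 t) x) - M2 x *: dHdp D M2 x (grad (u2 t) x))
   - (averaged_diff (fun z => HL D z.1.1 z.1.2 z.2) (grad (u1 t)) M1 (M1 - M2)
      - averaged_diff (fun z => HL D z.1.1 z.1.2 z.2) (grad (u2 t)) M2 (M1 - M2))).
Proof.
move=> S1 S2 tI E1 E2.
have tI' : 0 <= t <= T by case/andP: tI => ? ?; rewrite !ltW.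
have [Cu1 Cm1 _] := solution_slice S1 tI'.
have [Cu2 Cm2 _] := solution_slice S2 tI'.
have [_ [C12u1 C12m1] _ hj1 fp1 _ _] := S1.
have [_ [C12u2 C12m2] _ hj2 fp2 _ _] := S2.
have [a1 ca1 da1] := C12_is_derive C12u1.
have [a2 ca2 da2] := C12_is_derive C12u2.
have [b1 cb1 db1] := C12_is_derive C12m1.
have [b2 cb2 db2] := C12_is_derive C12m2.
have [cu1 _ _ _] := C12u1; have [cu2 _ _ _] := C12u2.
have [cm1 _ _ _] := C12m1; have [cm2 _ _ _] := C12m2.
have D1 (f ft : R -> 'rV[R]_d -> R) x :
    (forall t x, 0 < t < T -> is_derive t (1 : R) (f ^~ x) (ft t x)) ->
    derive1 (f ^~ x) t = ft t x.
  by move=> df; rewrite derive1E; case: (df t x tI).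
pose G s x := (u1 s x - u2 s x) * (b1 s x - b2 s x) +
  (a1 s x - a2 s x) * (m1 s x - m2 s x).
have cw := continuous_subf cu1 cu2; have cmu := continuous_subf cm1 cm2.
have ca := continuous_subf ca1 ca2; have cb := continuous_subf cb1 cb2.
have dG s x : 0 < s < T -> is_derive s (1 : R)
    (fun s => (u1 s x - u2 s x) * (m1 s x - m2 s x)) (G s x).
  move=> sI.
  have du := is_deriveB (da1 s x sI) (da2 s x sI).
  have dm := is_deriveB (db1 s x sI) (db2 s x sI).
  have [dp pE] := is_deriveM du dm.
  split; first exact: dp.
  by rewrite [LHS]pE /G [X in _ + X]mulrC.
have := haar_time_derivative (F := fun s x => (u1 s x - u2 s x) * (m1 s x - m2 s x))
  (continuous_mulf cw cmu)
  (continuous_addf (continuous_mulf cw cb) (continuous_mulf ca cmu)) dG tI.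
suff -> : \int[haar]_x G t x = \int[haar]_x dot (grad (u1 t) x - grad (u2 t) x)
     (flux D M1 (grad (u1 t)) x - flux D M2 (grad (u2 t)) x)
   - (averaged_diff (fun z => HL D z.1.1 z.1.2 z.2) (grad (u1 t)) M1 (M1 - M2)
      - averaged_diff (fun z => HL D z.1.1 z.1.2 z.2) (grad (u2 t)) M2 (M1 - M2)) by [].
rewrite -(@energy_identity R d n D hH hC2 nu M1 M2 (u1 t) (u2 t) (a1 t) (a2 t) (b1 t) (b2 t)).
- by rewrite E1 E2.
- exact: Cu1.
- exact: Cu2.
- by rewrite E1.
- by rewrite E2.
- exact: within_slice tI' ca1.
- exact: within_slice tI' ca2.
- by move=> x; rewrite /nonlocal E1 -(D1 _ _ x da1); exact: hj1.
- by move=> x; rewrite /nonlocal E2 -(D1 _ _ x da2); exact: hj2.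
- by move=> x; rewrite /flux E1 -(D1 _ _ x db1); exact: fp1.
- by move=> x; rewrite /flux E2 -(D1 _ _ x db2); exact: fp2.
Qed.

(** The pairing Phi is nonincreasing and vanishes at both ends, so its derivative,
    the energy, is zero at every interior time. *)
Lemma densities_agree u1 m1 u2 m2 : classical_solution D T nu uT m0 u1 m1 ->
  classical_solution D T nu uT m0 u2 m2 -> forall t, 0 < t < T ->
  m1 t = m2 t /\
  {ae @haar R d, forall x, m1 t x = 0 \/ grad (u1 t) x = grad (u2 t) x}.
Proof.
move=> S1 S2.
have [_ [[cu1 _ _ _] [cm1 _ _ _]] _ _ _ i1 e1] := S1.
have [_ [[cu2 _ _ _] [cm2 _ _ _]] _ _ _ i2 e2] := S2.
pose Phi s := \int[haar]_x ((u1 s x - u2 s x) * (m1 s x - m2 s x)).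
pose Psi s := Phi (clamp T s).
have cPsi : continuous Psi.
  exact: (haar_time_continuous T0 (F := fun s x => (u1 s x - u2 s x) * (m1 s x - m2 s x))
    (continuous_mulf (continuous_subf cu1 cu2) (continuous_subf cm1 cm2))).
have vanish (f : 'rV[R]_d -> R) : (forall x, f x = 0) -> \int[haar]_x f x = 0.
  by move=> f0; under eq_Rintegral do rewrite f0; rewrite Rintegral_cst// mul0r.
have Psi0 : Psi 0 = 0.
  rewrite /Psi clamp_id ?lexx ?(ltW T0)//; apply: vanish => x.
  by rewrite i1 i2 subrr mulr0.
have PsiT : Psi T = 0.
  rewrite /Psi clamp_id ?lexx ?(ltW T0)//; apply: vanish => x.
  by rewrite e1 e2 subrr mul0r.
have dPsi t (l : R) : 0 < t < T -> is_derive t (1 : R) Phi l -> is_derive t (1 : R) Psi l.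
  move=> tI; apply: near_eq_is_derive.
  have : t \in `]0, T[ by rewrite in_itv.
  move=> /near_in_itvoo; apply: filterS => s; rewrite in_itv/= => /andP[s0 sT].
  by rewrite /Psi clamp_id// !ltW.
have key t : 0 < t < T -> exists l : R, [/\ is_derive t (1 : R) Psi l, l <= 0 &
    l = 0 -> m1 t = m2 t /\
    {ae @haar R d, forall x, m1 t x = 0 \/ grad (u1 t) x = grad (u2 t) x}].
  move=> tI; have tI' : 0 <= t <= T by case/andP: tI => ? ?; rewrite !ltW.
  have [Cu1 [[pm1 cmt1 _] _] dens1] := solution_slice S1 tI'.
  have [Cu2 [[pm2 cmt2 _] _] dens2] := solution_slice S2 tI'.
  have [M1 E1] := ctorus_of cmt1 pm1; have [M2 E2] := ctorus_of cmt2 pm2.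
  have [cp1 pp1] := torus_C2_grad Cu1; have [cp2 pp2] := torus_C2_grad Cu2.
  have dP := dPsi t _ tI (duality_derivative S1 S2 tI E1 E2).
  have [||le0 eq0] := energy_le0 hC2 hconvex hconcave _ _ cp1 cp2 pp1 pp2 (m1 := M1) (m2 := M2).
  - by rewrite E1.
  - by rewrite E2.
  eexists; split; [exact dP|exact le0|].
  by move=> /eq0[M12 H]; rewrite -E1; split; [rewrite M12|].
have dPsi_le (s : R) : s \in `]0, T[ -> derivable Psi s 1 /\ derive1 Psi s <= 0.
  rewrite in_itv/= => /key[l [dl l0 _]]; split; first by case: dl.
  by rewrite derive1E; case: dl => _ ->.
have cPsiT : {within `[0, T], continuous Psi} by exact: continuous_subspaceT.
have mono := ler0_derive1_le_cc (fun s sI => (dPsi_le s sI).1)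
  (fun s sI => (dPsi_le s sI).2) cPsiT.
have Psi_0 s : 0 <= s <= T -> Psi s = 0.
  move=> /andP[s0 sT]; apply/eqP; rewrite eq_le.
  rewrite -{1}Psi0 -{2}PsiT; apply/andP; split; apply: mono => //;
    by rewrite in_itv/= ?lexx ?s0 ?sT ?(ltW T0).
move=> t tI; have [l [dl _]] := key t tI; apply.
have d0 : is_derive t (1 : R) Psi 0.
  apply: (near_eq_is_derive (f := cst 0)).
  have : t \in `]0, T[ by rewrite in_itv.
  move=> /near_in_itvoo; apply: filterS => s; rewrite in_itv/= => /andP[s0 sT].
  by rewrite Psi_0// !ltW.
by case: dl => _ <-; case: d0.
Qed.

(** Where the gradients of u1 and u2 agree, the two equations differ by the linear
    terms only: the local Hamiltonians cancel there, and the nonlocal terms are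
    integrals that coincide almost everywhere in xi. *)
Lemma values_le u1 m1 u2 m2 : classical_solution D T nu uT m0 u1 m1 ->
  classical_solution D T nu uT m0 u2 m2 ->
  forall t x, 0 < t < T -> u1 t x - u2 t x <= 0.
Proof.
move=> S1 S2.
have slice t : 0 <= t <= T -> torus_C2 (u1 t) /\ torus_C2 (u2 t).
  by move=> tI; have [? _ _] := solution_slice S1 tI; have [? _ _] := solution_slice S2 tI.
have [_ [C12u1 _] _ hj1 _ _ e1] := S1.
have [_ [C12u2 _] _ hj2 _ _ e2] := S2.
have [a1 _ da1] := C12_is_derive C12u1.
have [a2 _ da2] := C12_is_derive C12u2.
have [cu1 _ _ _] := C12u1; have [cu2 _ _ _] := C12u2.
apply: (@parabolic_maximum R d T nu (fun t x => u1 t x - u2 t x)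
  (fun t x => a1 t x - a2 t x) T0 nu0).
- exact: continuous_subf cu1 cu2.
- by move=> t /slice[? ?]; exact: torus_C2B.
- by move=> t x tI; exact: is_deriveB (da1 t x tI) (da2 t x tI).
- by move=> x; rewrite e1 e2 subrr.
move=> t x tI; have tI' : 0 <= t <= T by case/andP: tI => ? ?; rewrite !ltW.
have [Cu1 Cu2] := slice t tI'.
rewrite (gradB x (proj1 Cu1) (proj1 Cu2)) (laplacianB x Cu1 Cu2) => /eqP.
rewrite subr_eq0 => /eqP gx.
have [mE aeE] := densities_agree S1 S2 tI.
have := hj1 t x tI; have := hj2 t x tI; rewrite -mE -gx !derive1E.
have [_ ->] := da1 t x tI; have [_ ->] := da2 t x tI.
suff -> : \int[haar]_xi (dH D (m1 t) xi (grad (u2 t) xi) x * m1 t xi) =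
    \int[haar]_xi (dH D (m1 t) xi (grad (u1 t) xi) x * m1 t xi).
  move: (HL D _ _ _) (Rintegral _ _ _) => h N.
  move: (a1 t x) (a2 t x) (laplacian _ x) (laplacian _ x) => y1 y2 l1 l2 ? ?.
  by rewrite mulrBr; lra.
have [_ Cm1 _] := solution_slice S1 tI'.
have [[pm1 cm1 _] _] := Cm1; have [M1 E1] := ctorus_of cm1 pm1.
have [_ _ /(_ M1 (ctorus_Lfun1 M1))[_ _ _ mdH] _] := hH; rewrite E1 in mdH.
have mint u : torus_C2 u -> measurable_fun setT
    (EFin \o (fun xi => dH D (m1 t) xi (grad u xi) x * m1 t xi)).
  move=> /torus_C2_grad[cg _]; apply/measurable_EFinP; apply: measurable_funM.
    have mg : measurable_fun setT (fun xi : 'rV[R]_d => (xi, grad u xi, x)).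
      apply: measurable_fun_pair => //; apply: measurable_fun_pair => //.
      apply: measurable_fun_rV => i; apply: continuous_measurable_rV => y.
      apply: (@continuous_comp _ _ _ (grad u) (fun y : 'rV[R]_d => y ord0 i)); first exact: cg.
      exact: coord_continuous.
    exact: (measurableT_comp mdH mg).
  exact: continuous_measurable_rV.
rewrite /Rintegral; congr fine; apply: ae_eq_integral => //; [exact: mint|exact: mint|].
by apply: filterS aeE => xi [m0' _|-> _]//; rewrite m0' !mulr0.
Qed.

End solutions.

Theorem theorem4 (R : realType) (d n : nat) (D : mfc_data R d n)
    (T nu : R) (uT m0 : 'rV[R]_d -> R)
    (hd : (0 < d)%N) (hn : (0 < n)%N)
    (hD : mfc_assumptions D) (hT : 0 < T) (hnu : 0 < nu)
    (huT : smooth uT /\ Zperiodic uT)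
    (hh : forall mu, on_torus mu -> forall x, hP D mu x = uT x)
    (hm0 : smooth m0 /\ Zperiodic m0)
    (hm0_pos : forall x, 0 < m0 x)
    (hm0_density : prob_density m0)
    (hC2 : C2 (fun z : ctorus R d * 'rV[R]_d * 'rV[R]_d =>
                 HL D z.1.1 z.1.2 z.2))
    (hconvex : forall (m : ctorus R d) (p : 'rV[R]_d -> 'rV[R]_d),
       prob_density m -> continuous p -> Zperiodic p ->
       forall mu : ctorus R d, mu != 0 -> 0 < D2 (calH D p) m mu mu)
    (hconcave : forall m : ctorus R d, prob_density m ->
       forall x, strictly_concave (HL D m x)) :
  forall u1 m1 u2 m2 : R -> 'rV[R]_d -> R,
    classical_solution D T nu uT m0 u1 m1 ->
    classical_solution D T nu uT m0 u2 m2 ->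
    forall t x, 0 <= t <= T -> u1 t x = u2 t x /\ m1 t x = m2 t x.
Proof.
move=> u1 m1 u2 m2 S1 S2 t x tI.
have [_ _ _ hH] := hD.
have [_ [[cu1 _ _ _] [cm1 _ _ _]] _ _ _ _ _] := S1.
have [_ [[cu2 _ _ _] [cm2 _ _ _]] _ _ _ _ _] := S2.
have close (f1 f2 : R -> 'rV[R]_d -> R) :
    {within (`[0, T]%classic : set R) `*` [set: 'rV[R]_d],
      continuous (fun z : R * 'rV[R]_d => f1 z.1 z.2)} ->
    {within (`[0, T]%classic : set R) `*` [set: 'rV[R]_d],
      continuous (fun z : R * 'rV[R]_d => f2 z.1 z.2)} ->
    (forall s, 0 < s < T -> f1 s x = f2 s x) -> f1 t x = f2 t x.
  move=> c1 c2 f12; apply/eqP; rewrite -subr_eq0; apply/eqP.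
  have cf := continuous_subf (continuous_clamped hT (x := x) c1)
    (continuous_clamped hT (x := x) c2).
  have := continuous_zero_itv hT cf _ tI; rewrite clamp_id//; apply=> s sI.
  have sI' : 0 <= s <= T by case/andP: sI => ? ?; rewrite !ltW.
  by rewrite clamp_id// f12// subrr.
split; apply: close => // s sI; last first.
  by have [-> _] := densities_agree hH hT hC2 hconvex hconcave S1 S2 sI.
have le := values_le hH hT hnu hC2 hconvex hconcave.
have := le _ _ _ _ _ _ S1 S2 s x sI; have := le _ _ _ _ _ _ S2 S1 s x sI.
by rewrite !subr_le0 => u21 u12; apply/eqP; rewrite eq_le u12.
Qed.
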